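(* Let $G=(U,E)$ be a chordal graph and let $\mathcal{Q}$ be the set of its inclusion-wise maximal cliques. Arc-consistency of the constraint $\textsc{MaxWIS}(X_1,\dots,X_n,Z,G,w)$ can be achieved in $O(|\mathcal{Q}||E|)$ time.
   Context: $G=(U,E)$ is a finite undirected chordal graph (no induced cycle of length at least four) with vertex set $U=\{v_1,\dots,v_n\}$ and vertex weights $w_i\in\mathbb{N}$. $X_1,\dots,X_n$ are variables with domains $D(X_i)\subseteq\{0,1\}$, and $Z$ is an integer cost variable whose domain has minimum $\underline{Z}$ and maximum $\overline{Z}$. The constraint $\textsc{MaxWIS}(X_1,\dots,X_n,Z,G,w)$ requires that $\{v_i : X_i=1\}$ is a stable (independent) set of $G$, and that $\sum_{i=1}^n w_iX_i\ge Z$. Achieving arc-consistency means: given the current domains, compute the maximum weight $z^*$ of a stable set $S$ of $G$ compatible with the domains (i.e. $1\in D(X_i)$ for $v_i\in S$ and $0\in D(X_i)$ for $v_i\notin S$), tighten the upper bound of $Z$ to $z^*$, and remove from each $D(X_i)$ exactly those values $a$ for which there is no stable set, compatible with the domains, of weight at least $\underline{Z}$ and whose characteristic vector has $i$-th coordinate $a$ (reporting inconsistency if no compatible stable set of weight at least $\underline{Z}$ exists). Running time is counted in elementary (unit-cost arithmetic) operations, with the convention that $|U|=O(|E|)$, so that an algorithm running in time linear in the size of $G$ runs in $O(|E|)$. *)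

(* Defs.v *)
From HB Require Import structures.
From mathcomp Require Import all_boot all_order all_algebra.

Set Implicit Arguments.
Unset Strict Implicit.
Unset Printing Implicit Defensive.

Import Order.TTheory GRing.Theory Num.Theory.

(** * Graphs: symmetric irreflexive relations on ['I_n] *)

Section Graphs.
Variables (n : nat) (e : rel 'I_n).

Definition edges : {set {set 'I_n}} :=
  [set [set p.1; p.2] | p : 'I_n * 'I_n & e p.1 p.2].

Definition clique (A : {set 'I_n}) : bool :=
  [forall x in A, forall y in A, (x != y) ==> e x y].

Definition maximal_cliques : {set {set 'I_n}} := [set A | maxset clique A].

Definition stable (S : {set 'I_n}) : bool :=
  [forall x in S, forall y in S, ~~ e x y].

(* The only edges among the vertices of the cycle [c] are those of [c]. *)
Definition induced_cycle (c : seq 'I_n) : Prop :=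
  ucycle e c /\
  {in c &, forall x y, e x y -> (y == next c x) || (x == next c y)}.

Definition chordal : Prop :=
  forall c : seq 'I_n, 4 <= size c -> ~ induced_cycle c.

(* The order inside each list is arbitrary. *)
Definition adjacency_lists (adj : 'I_n -> seq 'I_n) : Prop :=
  forall i, uniq (adj i) /\ adj i =i e i.

End Graphs.

(** * The constraint MaxWIS and its filtering *)

Section MaxWIS.
Local Open Scope ring_scope.
Variables (n : nat) (e : rel 'I_n) (w : 'I_n -> nat).

Definition weight (S : {set 'I_n}) : nat := (\sum_(i in S) w i)%N.

(* An assignment X of the 0/1 variables is given by S = {v_i : X_i = 1}. *)
Definition maxwis (S : {set 'I_n}) (z : int) : bool :=
  stable e S && (z <= (weight S)%:Z).

Variables (D : 'I_n -> {set bool}) (zlo zhi : int).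

Definition compatible (S : {set 'I_n}) : bool :=
  [forall i, (i \in S) \in D i].

(* Meaningful only when some stable set is compatible with the domains. *)
Definition zstar : nat :=
  (\max_(S : {set 'I_n} | stable e S && compatible S) weight S)%N.

Definition consistent : bool :=
  [exists S : {set 'I_n}, compatible S && maxwis S zlo].

Definition filtered (i : 'I_n) : {set bool} :=
  [set a in D i | [exists S : {set 'I_n},
     [&& compatible S, maxwis S zlo & (i \in S) == a]]].

End MaxWIS.

(** * A unit-cost random access machine

    Programs work on integer variables and on arrays of integers, each
    addressed by a number.  As a fixed program mentions only finitely many
    arrays, they could be interleaved in a single memory at the price of a
    constant factor.  There is no multiplication: with unbounded integers it
    would make the unit-cost measure unreasonably powerful. *)

Section Machine.
Local Open Scope ring_scope.

Inductive expr : Type :=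
| Const of int
| Var of nat
| Get of nat & expr
| Add of expr & expr
| Sub of expr & expr.

(* [If e1 e2] and [While e1 e2] test whether [e1 <= e2]. *)
Inductive cmd : Type :=
| Skip
| Assign of nat & expr
| Put of nat & expr & expr
| Seq of cmd & cmd
| If of expr & expr & cmd & cmd
| While of expr & expr & cmd.

Record state : Type := State {
  var : nat -> int;
  arr : nat -> int -> int
}.

Definition set_var (s : state) (x : nat) (v : int) : state :=
  State (fun y => if y == x then v else var s y) (arr s).

Definition set_arr (s : state) (a : nat) (k v : int) : state :=
  State (var s)
    (fun b j => if (b == a) && (j == k) then v else arr s b j).

Fixpoint eval (s : state) (t : expr) : int :=
  match t with
  | Const c => c
  | Var x => var s x
  | Get a t1 => arr s a (eval s t1)
  | Add t1 t2 => eval s t1 + eval s t2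
  | Sub t1 t2 => eval s t1 - eval s t2
  end.

Fixpoint ecost (t : expr) : nat :=
  match t with
  | Const _ | Var _ => 1
  | Get _ t1 => (ecost t1).+1
  | Add t1 t2 | Sub t1 t2 => (ecost t1 + ecost t2).+1
  end.

(* [exec c s t s']: started in [s], the program [c] halts in [s'] after [t]
   elementary operations. *)
Inductive exec : cmd -> state -> nat -> state -> Prop :=
| ExecSkip s : exec Skip s 1 s
| ExecAssign x u s :
    exec (Assign x u) s (ecost u).+1 (set_var s x (eval s u))
| ExecPut a k u s :
    exec (Put a k u) s (ecost k + ecost u).+1
      (set_arr s a (eval s k) (eval s u))
| ExecSeq c1 c2 s s1 s2 t1 t2 :
    exec c1 s t1 s1 -> exec c2 s1 t2 s2 ->
    exec (Seq c1 c2) s (t1 + t2)%N s2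
| ExecIfTrue u v c1 c2 s s1 t :
    eval s u <= eval s v -> exec c1 s t s1 ->
    exec (If u v c1 c2) s (ecost u + ecost v + t).+1 s1
| ExecIfFalse u v c1 c2 s s1 t :
    eval s v < eval s u -> exec c2 s t s1 ->
    exec (If u v c1 c2) s (ecost u + ecost v + t).+1 s1
| ExecWhileTrue u v c s s1 s2 t1 t2 :
    eval s u <= eval s v -> exec c s t1 s1 -> exec (While u v c) s1 t2 s2 ->
    exec (While u v c) s (ecost u + ecost v + t1 + t2).+1 s2
| ExecWhileFalse u v c s :
    eval s v < eval s u ->
    exec (While u v c) s (ecost u + ecost v).+1 s.

End Machine.

(** * Input and output conventions *)

Definition var_n : nat := 0.
Definition var_zlo : nat := 1.
Definition var_zhi : nat := 2.
Definition var_consistent : nat := 3.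

Definition arr_offset : nat := 0.
Definition arr_adj : nat := 1.
Definition arr_weight : nat := 2.
Definition arr_dom (a : bool) : nat := if a then 4 else 3.

Section InputOutput.
Local Open Scope ring_scope.
Variable n : nat.

Definition cells (s : seq int) (k : int) : int :=
  if k is Posz j then nth 0 s j else 0.

Definition table (f : 'I_n -> int) : int -> int :=
  cells [seq f i | i <- enum 'I_n].

Variables (adj : 'I_n -> seq 'I_n) (w : 'I_n -> nat).
Variables (D : 'I_n -> {set bool}) (zlo zhi : int).

(* The adjacency lists are concatenated in [arr_adj]; that of vertex i fills
   the cells from offset(i) to offset(i+1) - 1. *)
Definition input : state :=
  State
    (fun x => if x == var_n then n%:Z
              else if x == var_zlo then zlo
              else if x == var_zhi then zhi
              else 0)
    (fun b => if b == arr_offset then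
                cells [seq (\sum_(i < n | (i < k)%N) size (adj i))%N%:Z
                      | k <- iota 0 n.+1]
              else if b == arr_adj then
                cells [seq (nat_of_ord j)%:Z
                      | j <- flatten [seq adj i | i <- enum 'I_n]]
              else if b == arr_weight then table (fun i => (w i)%:Z)
              else if b == arr_dom false then
                table (fun i => (false \in D i : nat)%:Z)
              else if b == arr_dom true then
                table (fun i => (true \in D i : nat)%:Z)
              else fun=> 0).

Variable e : rel 'I_n.

(* In case of consistency, the new upper bound of Z and the new domains of
   the X_i replace the old ones. *)
Definition arc_consistency_achieved (s : state) : Prop :=
  var s var_consistent = (consistent e w D zlo : nat)%:Z /\
  (consistent e w D zlo ->
     var s var_zhi = Num.min zhi (zstar e w D)%:Z /\
     forall (i : 'I_n) (a : bool),
       arr s (arr_dom a) (nat_of_ord i)%:Z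
         = (a \in filtered e w D zlo i : nat)%:Z).

End InputOutput.

(* Main.v *)
Require Import Defs.
From HB Require Import structures.
From mathcomp Require Import all_boot all_order all_algebra.
From mathcomp Require Import zify.

Set Implicit Arguments.
Unset Strict Implicit.
Unset Printing Implicit Defensive.

Import Order.TTheory GRing.Theory Num.Theory.

(** Give [v] the integer weight [w v], raised by a large [M] if [v] is forced
    into the set and lowered by [M] if it is forbidden.  The stable sets
    reaching a certain threshold are then exactly the compatible ones of weight
    at least [zlo], so that filtering asks for the maximum weight of a stable
    set containing, respectively missing, each single vertex.

    Maximum cardinality search visits a chordal graph in the reverse of a
    perfect elimination order.  Eliminating a simplicial vertex [v] of residual
    weight [r] amounts to adding [max(r, 0)] to a constant and subtracting it
    from the neighbours of [v], since a stable set contains at most one of them.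
    This yields the maximum weight [alpha].  Then, in visit order, let [C] be
    the clique of the earlier neighbours of [v] and [A] the maximum weight of a
    stable set missing [C]: the optimum containing [v] is [A + min(r, 0)], the
    one missing both [C] and [v] is [A - max(r, 0)].  If [C] is empty then
    [A = alpha].  Otherwise let [u] be the last visited vertex of [C]: a stable
    set missing [C] either misses [u] and its earlier neighbours, or contains
    exactly one earlier neighbour of [u] outside [C], and both optima are
    already known.

    All this takes O(n^2) operations.  Assigning to each vertex a maximal clique
    containing it, the Cauchy-Schwarz inequality gives
    n^2 <= |Q| (2 |E| + n). *)

(** * Maximum cardinality search *)

Lemma next_cat_cons (T : eqType) (p q : seq T) (x y : T) :
  uniq (p ++ x :: y :: q) -> next (p ++ x :: y :: q) x = y.
Proof.
by move=> u; rewrite -(next_rot (size p) u) rot_size_cat /= eqxx.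
Qed.

Lemma next_rcons_last (T : eqType) (p : seq T) (x y : T) :
  uniq (x :: rcons p y) -> next (x :: rcons p y) y = x.
Proof.
move=> u; have u' : uniq (y :: x :: p).
  by rewrite -(rot_uniq 1) rot1_cons rcons_cons.
by rewrite -(next_rotr 1 u) -rcons_cons rotr1_rcons /= eqxx.
Qed.

Lemma rcons_eq_cat_cons (T : Type) (s p q : seq T) (z x : T) :
  rcons s z = p ++ x :: q ->
  (q = [::] /\ x = z /\ p = s) \/
  (exists q', q = rcons q' z /\ s = p ++ x :: q').
Proof.
case/lastP: q => [|q t].
  by rewrite cats1 => /rcons_inj[-> ->]; left.
by rewrite -rcons_cons -rcons_cat => /rcons_inj[-> ->]; right; exists q.
Qed.

Lemma in_split_cat (T : eqType) (x : T) (s : seq T) :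
  x \in s -> exists p q, s = p ++ x :: q.
Proof. by case/splitPr => p q; exists p, q. Qed.

Lemma ltn_count (T : eqType) (a b : pred T) (s : seq T) (x : T) :
  {in s, subpred a b} -> x \in s -> b x -> ~~ a x -> count a s < count b s.
Proof.
move=> sab xs bx nax; have /permP pe := perm_to_rem xs.
rewrite !pe /= bx (negPf nax) ltnS.
have : {in rem x s, subpred a b} by move=> z /mem_rem/sab.
elim: (rem x s) => //= z l IHl sl.
have := sl z (mem_head _ _); have /IHl : {in l, subpred a b}.
  by move=> t tl; apply: sl; rewrite inE tl orbT.
by case: (a z) => [? ->//|?]; case: (b z) => /=; lia.
Qed.

Section SearchOrders.
Variables (n : nat) (e : rel 'I_n).
Hypotheses (e_sym : symmetric e) (e_irr : irreflexive e).
Implicit Types (o p q s : seq 'I_n) (a b c d u v x y z : 'I_n).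

(** The order may be partial: [c] ranges over all vertices outside [p], also those absent from [o],
    so that the property can serve as an invariant of the search loop. *)
Definition cardinality_search o : Prop :=
  forall p b q, o = p ++ b :: q ->
  forall c, c \notin p -> count (e c) p <= count (e b) p.

Definition reverse_peo o : Prop :=
  forall p v q, o = p ++ v :: q ->
  {in p &, forall x y, e v x -> e v y -> x != y -> e x y}.

(** For a duplicate-free list this is an induced path: two entries are adjacent exactly when nothing
    lies between them. *)
Definition chordless s : Prop :=
  forall p x q y r, s = p ++ x :: q ++ y :: r -> e x y = nilp q.

Lemma chordless_catl s p : chordless (s ++ p) -> chordless s.
Proof.
move=> ch p1 x q y r E; apply: (ch p1 x q y (r ++ p)).
by rewrite E -!catA /= -catA.
Qed.

Lemma chordless_catr s p : chordless (p ++ s) -> chordless s.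
Proof.
move=> ch p1 x q y r E; apply: (ch (p ++ p1) x q y r).
by rewrite E -!catA.
Qed.

Lemma chordless_rev s : chordless s -> chordless (rev s).
Proof.
move=> ch p x q y r E.
rewrite e_sym (ch (rev r) y (rev q) x (rev p)) /nilp ?size_rev //.
by rewrite -[s]revK E !(rev_cat, rev_cons) -!cats1 -!catA.
Qed.

Lemma chordless_rcons s z d :
  chordless (rcons s z) -> e z d -> {in s, forall x, ~~ e d x} ->
  chordless (rcons (rcons s z) d).
Proof.
move=> ch ezd ns p x q y r.
rewrite -[_ ++ _]/(p ++ (x :: q) ++ y :: r) catA => E0.
case: (rcons_eq_cat_cons E0) => [[_ [-> E]]|[r' [_]]]; last by rewrite -catA; apply: ch.
case: (rcons_eq_cat_cons (esym E)) => [[-> [-> _]]|[q' [-> Es]]] //.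
rewrite /nilp size_rcons e_sym; apply/negbTE/ns.
by rewrite Es mem_cat mem_head orbT.
Qed.

Lemma chordless_path x s : chordless (x :: s) -> path e x s.
Proof.
elim: s x => //= y s IHs x ch.
by rewrite (ch [::] x [::] y s) //= IHs //; apply: (@chordless_catr _ [:: x]).
Qed.

Lemma chordless_cycle a s z d :
  chordless (a :: rcons s z) -> uniq (a :: rcons (rcons s z) d) ->
  e d a -> e z d -> {in s, forall x, ~~ e d x} ->
  induced_cycle e (a :: rcons (rcons s z) d).
Proof.
move=> ch u eda ezd nds; set C := _ :: _.
(* By symmetry of adjacency, only a chord whose first end [x] comes earlier in the list matters. If
   [y] is not [d], both ends lie on the induced path. If [y] is [d], then [x] is [z] or [a], since
   [d] has no neighbour in [s]. *)
have half x p q y r : C = p ++ x :: q ++ y :: r -> e x y ->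
    (y == next C x) || (x == next C y).
  move=> E exy.
  have E0 : rcons (a :: rcons s z) d = (p ++ x :: q) ++ y :: r by rewrite -catA.
  case: (rcons_eq_cat_cons E0) => [[_ [Ey E1]]|[r' [Er]]]; last first.
    rewrite -catA => E1; have := ch _ _ _ _ _ E1; rewrite exy => /esym/nilP q0.
    have uC : uniq (p ++ x :: q ++ y :: r) by rewrite -E.
    by rewrite E; rewrite q0 in uC *; rewrite next_cat_cons ?eqxx.
  move: E1 => /esym; rewrite -rcons_cons => E0'.
  case: (rcons_eq_cat_cons E0') => [[_ [-> _]]|[q' [_ E1]]].
    rewrite Ey /C -cats1 -cats1 -catA -cat_cons next_cat_cons ?eqxx //.
    by move: u; rewrite -cats1 -cats1 -catA.
  case: p E1 {E E0 E0'} => [|b p] [Ea Es].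
    by rewrite -Ea Ey [X in _ || (_ == X)](next_rcons_last u) eqxx orbT.
  have /nds : x \in s by rewrite Es mem_cat mem_head orbT.
  by rewrite e_sym -Ey exy.
split.
  rewrite /ucycle u andbT /= rcons_path last_rcons eda andbT.
  by rewrite rcons_path last_rcons ezd andbT chordless_path.
move=> x y xC yC exy; have xy : x != y.
  by apply: contraTneq exy => ->; rewrite e_irr.
have [p [q EC]] := in_split_cat xC.
move: yC; rewrite EC mem_cat inE eq_sym (negPf xy) /=.
case/orP => /in_split_cat [p1 [p2 Ep]].
  rewrite -EC orbC; apply: (half y p1 p2 x q); last by rewrite e_sym.
  by rewrite EC Ep -catA.
by rewrite -EC; apply: (half x p p1 y p2); rewrite // EC Ep.
Qed.

(** When [b] was chosen, [c] was still unvisited and had the visited neighbour [a], which [b] lacks.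
    As [b] had at least as many visited neighbours as [c], it must have one that [c] lacks. *)
Lemma cardinality_search_gap o a b c :
  cardinality_search o -> b \in o ->
  index a o < index b o -> index b o < index c o -> e a c -> ~~ e a b ->
  exists d, [/\ index d o < index b o, e d b & ~~ e d c].
Proof.
move=> so bo ab bc eac neab.
have Eo : o = take (index b o) o ++ b :: drop (index b o).+1 o.
  by rewrite -[X in _ ++ X :: _](nth_index b bo) -drop_nth ?index_mem ?cat_take_drop.
set p := take _ _ in Eo.
have inp x : (x \in p) = (index x o < index b o).
  by rewrite /p in_take_leq // ltnW // index_mem.
have /(so _ _ _ Eo) : c \notin p by rewrite inp -leqNgt ltnW.
case: (boolP (has (fun d => e b d && ~~ e c d) p)) => [|nh le].
  case/hasP => d; rewrite inp => db /andP[ebd necd] _.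
  by exists d; split; rewrite // e_sym.
suff : count (e b) p < count (e c) p by rewrite ltnNge le.
apply: (@ltn_count _ _ _ _ a); rewrite ?inp // 1?e_sym //.
move=> d dp ebd; apply: contraNT nh => necd.
by apply/hasP; exists d; rewrite // ebd.
Qed.

(* A counterexample to the elimination property is a path x, v, y with v
   visited last.  Among the chordless paths whose inner vertices are visited
   after both ends, the search rule always yields one whose ends are visited
   earlier. *)
Lemma no_detour o : cardinality_search o -> chordal e ->
  forall a s b, s != [::] -> {subset a :: rcons s b <= o} ->
  uniq (a :: rcons s b) ->
  chordless (a :: rcons s b) ->
  ~ {in s, forall z, (index a o < index z o) && (index b o < index z o)}.
Proof.
move=> so che a s b; have [m] := ubnP (maxn (index a o) (index b o)).
elim: m a s b => // m IHm a s b lem s0 sub u ch later.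
(* Reversing the path exchanges its ends. *)
wlog ab : a s b lem s0 sub u ch later / index a o < index b o.
  have aneb : a != b.
    by move: u => /= /andP[+ _]; apply: contraNneq => ->; rewrite mem_rcons mem_head.
  move=> wl; have [ab|] := ltnP (index a o) (index b o); first exact: (wl a s b).
  rewrite leq_eqVlt => /orP[/eqP E|ba].
    have := congr1 (nth a o) E; rewrite !nth_index ?sub ?mem_head //.
      by move=> E'; rewrite E' eqxx in aneb.
    by rewrite inE mem_rcons mem_head orbT.
  have Er : rev (a :: rcons s b) = b :: rcons (rev s) a.
    by rewrite rev_cons rev_rcons.
  apply: (wl b (rev s) a) => //.
  - by rewrite maxnC.
  - by rewrite -size_eq0 size_rev size_eq0.
  - by move=> z; rewrite -Er mem_rev; apply: sub.
  - by rewrite -Er rev_uniq.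
  - by rewrite -Er; apply: chordless_rev.
  - by move=> z; rewrite mem_rev => /later; rewrite andbC.
have bo : b \in o by apply: sub; rewrite inE mem_rcons mem_head orbT.
have neab : ~~ e a b.
  by rewrite (ch [::] a s b [::]) ?cats1 //; case: (s) s0.
case: s s0 => // c s _ in later sub u ch lem *.
have /andP[ac bc] := later c (mem_head _ _).
have eac : e a c by rewrite (ch [::] a [::] c (rcons s b)).
(* [c] is the path neighbour of [a]: it is visited after [b], and [b] is not adjacent to [a]. *)
have [d [db edb nedc]] := cardinality_search_gap so bo ab bc eac neab.
have do_ : d \in o by rewrite -index_mem (ltn_trans db) // index_mem.
have dcs : d \notin c :: s.
  by apply: contraTN db => /later /andP[_]; rewrite -leqNgt => /ltnW.
have dP : d \notin a :: rcons (c :: s) b.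
  rewrite in_cons mem_rcons in_cons (negPf dcs) orbF negb_or; apply/andP; split.
  - by apply: contraNneq neab => <-.
  - by apply: contraTneq db => ->; rewrite ltnn.
have hb : has (e d) (rcons (c :: s) b) by rewrite has_rcons edb.
(* Follow the path from [a] up to the first vertex [z] beyond [a] adjacent to [d]. It exists because
   [b] is adjacent to [d], and it is not [c], so [s1] is nonempty. *)
have [s1 [z [s2 [Es edz nds1]]]] : exists s1 z s2,
    [/\ rcons (c :: s) b = s1 ++ z :: s2, e d z & {in s1, forall x, ~~ e d x}].
  case/split_find: hb => z s1 s2 edz nh; exists s1, z, s2.
  by split=> //; [rewrite cat_rcons | move=> x xs; apply: (hasPn nh)].
have s10 : s1 != [::].
  by case: (s1) Es nds1 => // -[Ec _] _; rewrite Ec edz in nedc.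
have E2 : a :: rcons (c :: s) b = (a :: rcons s1 z) ++ s2 by rewrite Es cat_cons cat_rcons.
have ch1 : chordless (a :: rcons s1 z) by move: ch; rewrite E2; apply: chordless_catl.
have u1 : uniq (a :: rcons (rcons s1 z) d).
  rewrite -rcons_cons rcons_uniq; move: u; rewrite E2 cat_uniq => /andP[-> _].
  by rewrite andbT; apply: contra dP; rewrite E2 mem_cat => ->.
(* If [d] sees [a], the path closes into an induced cycle through [a], [s1], [z] and [d], hence of
   length at least four. Otherwise the path extended by [d] has its ends [a] and [d] visited before
   [b], and induction applies. *)
have [eda|neda] := boolP (e d a).
  apply: (che (a :: rcons (rcons s1 z) d)).
    by case: (s1) s10 => //= ? ? _; rewrite !size_rcons.
  by apply: chordless_cycle; rewrite // e_sym.
apply: (IHm a (rcons s1 z) d) => //.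
- move: lem; rewrite !gtn_max !ltnS => /andP[_ bm].
  by rewrite (leq_trans ab bm) (leq_trans db bm).
- by rewrite -size_eq0 size_rcons.
- move=> x; rewrite -rcons_cons mem_rcons inE => /orP[/eqP->//|xs].
  by apply: sub; rewrite E2 mem_cat xs.
- rewrite -rcons_cons -rcons_cons; apply: chordless_rcons; rewrite // 1?e_sym //.
  by move=> x; rewrite inE => /orP[/eqP->//|/nds1].
- move=> x xs; have : x \in rcons (c :: s) b.
    by rewrite Es -cat_rcons mem_cat xs.
  rewrite mem_rcons inE => /orP[/eqP->|/later/andP[-> bx]]; first by rewrite ab db.
  exact: ltn_trans bx.
Qed.

Lemma chordal_reverse_peo o :
  chordal e -> uniq o -> cardinality_search o -> reverse_peo o.
Proof.
move=> che uo so p v q Eo x y xp yp evx evy xy; apply/negPn/negP => nexy.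
have vp : v \notin p by move: uo; rewrite Eo cat_uniq /= !negb_or => /and3P[_ /andP[]].
have xv : x != v by apply: contraNneq vp => <-.
have vy : v != y by apply: contraNneq vp => ->.
apply: (@no_detour o so che x [:: v] y) => //.
- by move=> z; rewrite !inE Eo mem_cat inE => /or3P[] /eqP->; rewrite ?xp ?yp ?eqxx ?orbT.
- by rewrite /= !inE negb_or xv vy xy.
- move=> p1 x' q1 y' r E.
  have := congr1 size E; rewrite /= !size_cat /= !size_cat /= => sz.
  case: p1 E sz => [|x1 [|x2 p1]]; case: q1 => [|x3 [|x4 q1]] E /= sz;
    try by clear -sz; lia.
  + by case: E => <- <- _; rewrite e_sym evx.
  + by case: E => <- _ <- _; rewrite (negPf nexy).
  + by case: E => _ <- <- _; rewrite evy.
- move=> z; rewrite inE => /eqP->; rewrite Eo !index_cat xp yp (negPf vp) /= eqxx addn0.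
  by rewrite !index_mem xp yp.
Qed.

Lemma cardinality_search_nil : cardinality_search [::].
Proof. by case. Qed.

Lemma cardinality_search_rcons o b :
  cardinality_search o ->
  (forall c, c \notin o -> count (e c) o <= count (e b) o) ->
  cardinality_search (rcons o b).
Proof.
move=> so max p b' q; case/lastP: q => [|q t].
  by rewrite cats1 => /rcons_inj [<- <-].
by rewrite -rcons_cons -rcons_cat => /rcons_inj[/so].
Qed.

End SearchOrders.

(** * Maximum weight stable sets by elimination *)

Section Maxima.
Local Open Scope ring_scope.
Variables (T : Type) (f : T -> int).
Implicit Types (P Q : T -> Prop) (m d : int).

Definition is_max P m : Prop :=
  (exists2 x, P x & f x = m) /\ (forall x, P x -> f x <= m).

Lemma is_max_ext P Q m : (forall x, P x <-> Q x) -> is_max P m -> is_max Q m.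
Proof.
by move=> PQ [[x /PQ Qx fx] le]; split=> [|y /PQ/le //]; exists x.
Qed.

Lemma is_maxU P Q R m1 m2 :
  (forall x, R x <-> P x \/ Q x) ->
  is_max P m1 -> is_max Q m2 -> is_max R (Num.max m1 m2).
Proof.
move=> RE [[x Px fx] le1] [[y Qy fy] le2]; split.
  by case: (leP m1 m2) => _; [exists y | exists x] => //; apply/RE; auto.
by move=> z /RE[/le1|/le2]; rewrite le_max => ->; rewrite ?orbT.
Qed.

(** The difference [d] is the same in every class [j], so it survives taking the maximum over all
    classes. *)
Lemma is_max_shift (J : Type) (I : J -> Prop) (F G : J -> T -> Prop)
    (g : J -> int) P Q m d :
  (forall x, P x <-> exists2 j, I j & F j x) ->
  (forall x, Q x <-> exists2 j, I j & G j x) ->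
  (forall j, I j -> is_max (F j) (g j) /\ is_max (G j) (g j + d)) ->
  is_max P m -> is_max Q (m + d).
Proof.
move=> PE QE FG [[x Px fx] le]; split.
  have /PE [j Ij Fjx] := Px.
  have [[_ leF] [[y Gjy fy] _]] := FG j Ij.
  exists y; first by apply/QE; exists j.
  apply/eqP; rewrite fy eq_le lerD2r -{2}fx lerD2r leF // andbT.
  have [[z Fjz <-] _] := (FG j Ij).1; apply: le.
  by apply/PE; exists j.
move=> y /QE [j Ij Gjy].
have [[[x' Fjx' <-] _] [_ leG]] := FG j Ij.
by rewrite (le_trans (leG y Gjy)) // lerD2r le //; apply/PE; exists j.
Qed.

End Maxima.

Section StableSets.
Local Open Scope ring_scope.
Variables (n : nat) (e : rel 'I_n).
Hypotheses (e_sym : symmetric e) (e_irr : irreflexive e).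
Implicit Types (S P C : {set 'I_n}) (u v x y : 'I_n) (r c : 'I_n -> int).

Definition signed_weight c S : int := \sum_(i in S) c i.

Lemma stableP S : reflect {in S &, forall x y, ~~ e x y} (stable e S).
Proof.
apply: (iffP forall_inP) => [H x y xS yS|H x xS].
  by move/forall_inP: (H x xS); apply.
by apply/forall_inP => y yS; apply: H.
Qed.

Lemma stableU1 v S :
  stable e (v |: S) = stable e S && [forall x in S, ~~ e v x].
Proof.
apply/stableP/andP => [H|[/stableP H /forall_inP Hv] x y].
  split; first by apply/stableP => x y xS yS; apply: H; rewrite !inE ?xS ?yS orbT.
  by apply/forall_inP => x xS; apply: H; rewrite !inE ?xS ?eqxx ?orbT.
rewrite !inE => /predU1P[->|xS] /predU1P[->|yS].
- by rewrite e_irr.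
- exact: Hv.
- by rewrite e_sym; apply: Hv.
- exact: H.
Qed.

Lemma stableS S S' : S \subset S' -> stable e S' -> stable e S.
Proof.
move=> /subsetP sub /stableP H; apply/stableP => x y xS yS.
by apply: H; apply: sub.
Qed.

Lemma stable0 : stable e set0.
Proof. by apply/stableP => x y; rewrite inE. Qed.

Lemma signed_weightU1 c v S :
  v \notin S -> signed_weight c (v |: S) = c v + signed_weight c S.
Proof. by move=> vS; rewrite /signed_weight big_setU1. Qed.

Definition best c (Q : {set 'I_n} -> Prop) (m : int) : Prop :=
  is_max (signed_weight c) (fun S => stable e S /\ Q S) m.

(* Eliminating the vertices outside [P] has produced the residual weights [r]
   on [P] and the constant [D]. *)
Definition eliminated c P (D : int) r : Prop :=
  forall S', stable e S' -> S' \subset P ->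
  best c (fun S => S :&: P = S') (D + signed_weight r S').

Lemma eliminated_setT c : eliminated c setT 0 c.
Proof.
move=> S' st _; rewrite add0r; split.
  by exists S' => //; rewrite setIT.
by move=> S [_]; rewrite setIT => ->.
Qed.

Lemma eliminated_set0 c D r : eliminated c set0 D r -> best c (fun=> True) D.
Proof.
move=> /(_ set0 stable0 (sub0set _)).
rewrite /signed_weight big_set0 addr0.
by apply: is_max_ext => S; rewrite setI0; split=> -[].
Qed.

Lemma eq_eliminated c P D r r' :
  {in P, r =1 r'} -> eliminated c P D r -> eliminated c P D r'.
Proof.
move=> rr' el S' st sub.
rewrite [X in best _ _ (_ + X)](_ : _ = signed_weight r S'); first exact: el.
by apply: eq_bigr => x xS; rewrite rr' // (subsetP sub).
Qed.

(** With [A] the vertices visited before [v], the set avoids the clique of earlier neighbours of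
    [v]; whether it contains [v] is left open. *)
Definition misses v (A : pred 'I_n) S := [forall x in S, (x \in A) ==> ~~ e v x].

Lemma missesP v (A : pred 'I_n) S :
  reflect (forall x, x \in S -> x \in A -> ~~ e v x) (misses v A S).
Proof.
apply: (iffP forall_inP) => H x xS; first exact/implyP/H.
by apply/implyP/H.
Qed.

(** * Eliminating a simplicial vertex *)

Section Elimination.
Variables (c : 'I_n -> int) (P : {set 'I_n}) (v : 'I_n) (D : int) (r : 'I_n -> int).
Hypothesis vP : v \notin P.
Hypothesis Nv : {in P &, forall x y, e v x -> e v y -> x != y -> e x y}.
Hypothesis el : eliminated c (v |: P) D r.

Let misses S := misses v (mem P) S.

Lemma setIU1_out S : v \notin S -> S :&: (v |: P) = S :&: P.
Proof.
move=> vS; apply/setP => x; rewrite !inE; case: eqP => // ->.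
by rewrite (negPf vS).
Qed.

Lemma setIU1_in S : v \in S -> S :&: (v |: P) = v |: (S :&: P).
Proof. by move=> vS; apply/setP => x; rewrite !inE; case: eqP => // ->; rewrite vS. Qed.

Lemma eliminated_out S' : stable e S' -> S' \subset P ->
  best c (fun S => S :&: P = S' /\ v \notin S) (D + signed_weight r S').
Proof.
move=> st sub; have := el st (subset_trans sub (subsetUr _ _)).
apply: is_max_ext => S; split=> -[stS]; last by case=> ES vS; rewrite setIU1_out.
move=> ES; have vS : v \notin S.
  apply/negP => vS; have : v \in S' by rewrite -ES !inE vS eqxx.
  by move/(subsetP sub); apply/negP.
by rewrite -setIU1_out.
Qed.

Lemma eliminated_in S' : stable e S' -> S' \subset P -> misses S' ->
  best c (fun S => S :&: P = S' /\ v \in S) (D + r v + signed_weight r S').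
Proof.
move=> st sub /forall_inP ms.
have vS' : v \notin S' by apply: contra vP => /(subsetP sub).
have st' : stable e (v |: S').
  rewrite stableU1 st; apply/forall_inP => x xS.
  by have /implyP := ms x xS; apply; apply: (subsetP sub).
have := el st' (setUS _ sub); rewrite signed_weightU1 // addrA.
apply: is_max_ext => S; split=> -[stS].
  move=> ES; have vS : v \in S.
    by have := setU11 v S'; rewrite -ES inE => /andP[].
  split=> //; split=> //; move: ES; rewrite setIU1_in //.
  by move/(congr1 (fun A => A :\ v)); rewrite !setU1K // inE vS (negPf vP).
by case=> <- vS; rewrite setIU1_in.
Qed.

Definition gain : int := Num.max (r v) 0.

Definition reduced x : int := if (x \in P) && e v x then r x - gain else r x.

(** The neighbours of [v] in [P] form a clique, so a stable set contains at most one of them and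
    [gain] is subtracted at most once. *)
Lemma signed_weight_reduced S' : stable e S' -> S' \subset P ->
  signed_weight reduced S' =
    if misses S' then signed_weight r S' else signed_weight r S' - gain.
Proof.
move=> st sub; case: ifP => [/forall_inP ms|/negbT].
  apply: eq_bigr => x xS; rewrite /reduced.
  by have /implyP := ms x xS; case: (x \in P) => //= /(_ isT) /negPf ->.
rewrite negb_forall_in => /exists_inP [x xS]; rewrite negb_imply negbK => /andP[xP evx].
rewrite /signed_weight (bigD1 x) //= [in RHS](bigD1 x) //= /reduced xP evx /=.
rewrite [RHS]addrAC; congr (_ + _); apply: eq_bigr => y /andP[yS yx].
rewrite (subsetP sub) //=; case: ifP => // evy.
move/stableP: st => /(_ x y xS yS) /negP[].
by apply: Nv; rewrite // 1?eq_sym // (subsetP sub).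
Qed.

(** If [S'] has no neighbour of [v], then [v] may be added or not, whichever is better, which brings
    [gain]. Otherwise [v] is excluded, and the [gain] put into the constant is cancelled by the
    reduced weight of its neighbour. *)
Lemma eliminated_step : eliminated c P (D + gain) reduced.
Proof.
move=> S' st sub; rewrite signed_weight_reduced //.
have out := eliminated_out st sub; case: ifP => ms.
  have inn := eliminated_in st sub ms.
  rewrite [X in best _ _ X](_ : _ =
    Num.max (D + r v + signed_weight r S') (D + signed_weight r S')).
    by apply: is_maxU inn out => S; case: (boolP (v \in S)); intuition.
  by rewrite /gain; lia.
rewrite [X in best _ _ X](_ : _ = D + signed_weight r S'); last by lia.
apply: is_max_ext out => S; split=> -[stS]; first by case.
move=> ES; split=> //; split=> //; apply/negP => vS; move/negP: ms; apply.
apply/forall_inP => x; rewrite -ES inE => /andP[xS xP]; rewrite xP /=.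
by move/stableP: stS; apply.
Qed.

(** Classify stable sets by their trace [S'] on [P]. The trace alone decides [misses], and
    [eliminated_step] gives the optimum for each trace, so a shift common to all traces is a shift
    of the global optimum. *)
Lemma best_shift (G : {set 'I_n} -> Prop) (d M : int) :
  (forall S', stable e S' -> S' \subset P -> misses S' ->
     best c (fun S => S :&: P = S' /\ G S) (D + gain + signed_weight reduced S' + d)) ->
  best c (fun S => misses S) M ->
  best c (fun S => misses S /\ G S) (M + d).
Proof.
move=> HG; have msI S : misses (S :&: P) = misses S.
  apply/forall_inP/forall_inP => H x.
    by move=> xS; case: (boolP (x \in P)) => // xP; have := H x; rewrite inE xS xP => /(_ isT).
  by rewrite inE => /andP[xS _]; apply: H.
have sI S : stable e S -> stable e (S :&: P) by apply: stableS; apply: subsetIl.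
apply: (@is_max_shift _ _ _
  (fun S' => [/\ stable e S', S' \subset P & misses S'])
  (fun S' S => stable e S /\ S :&: P = S')
  (fun S' S => stable e S /\ (S :&: P = S' /\ G S))
  (fun S' => D + gain + signed_weight reduced S')).
- move=> S; split=> [[st ms]|[S' [_ _ ms] [st ES]]]; last by rewrite -msI ES.
  by exists (S :&: P); rewrite // subsetIr msI; split=> //; apply: sI.
- move=> S; split=> [[st [ms GS]]|[S' [_ _ ms] [st [ES GS]]]]; last by rewrite -msI ES.
  by exists (S :&: P); rewrite // subsetIr msI; split=> //; apply: sI.
move=> S' [st sub ms]; split; last exact: HG.
exact: eliminated_step.
Qed.

Lemma best_in (M : int) :
  best c (fun S => misses S) M ->
  best c (fun S => misses S /\ v \in S) (M + Num.min (r v) 0).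
Proof.
apply: best_shift => S' st sub ms; rewrite signed_weight_reduced // ms.
(* The positive part [gain] and the negative part of [r v] add up to [r v]. *)
rewrite [X in best _ _ X](_ : _ = D + r v + signed_weight r S').
  exact: eliminated_in.
by rewrite /gain; lia.
Qed.

Lemma best_out (M : int) :
  best c (fun S => misses S) M ->
  best c (fun S => misses S /\ v \notin S) (M - gain).
Proof.
apply: best_shift => S' st sub ms; rewrite signed_weight_reduced // ms.
rewrite [X in best _ _ X](_ : _ = D + signed_weight r S').
  exact: eliminated_out.
by lia.
Qed.

End Elimination.

(** * Optima at a vertex from the optima at earlier vertices *)

Section ClosedNeighbourhoods.
Variables (c : 'I_n -> int).
Implicit Type p : seq 'I_n.

Lemma best_misses_in v p m :
  best c (fun S => misses v (mem p) S /\ v \in S) m -> best c (fun S => v \in S) m.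
Proof.
apply: is_max_ext => S; split=> -[st]; first by case.
move=> vS; split=> //; split=> //; apply/missesP => x xS _.
by move/stableP: st; apply.
Qed.

(** One pass of a scanning loop: the running maximum takes in the sets through [x] when [x] passes
    the test [a]. Both loops that read [aIn] are instances. *)
Lemma best_rcons (Q : {set 'I_n} -> Prop) (a : pred 'I_n) p x m b :
  best c (fun S => Q S \/ exists y, [/\ y \in p, a y & y \in S]) m ->
  best c (fun S => x \in S) b ->
  best c (fun S => Q S \/ exists y, [/\ y \in rcons p x, a y & y \in S])
    (if a x then Num.max m b else m).
Proof.
move=> Hm Hb; case: ifP => ax; last first.
  apply: is_max_ext Hm => S; split=> -[st [QS|[y [yp ay yS]]]]; split=> //; auto.
    by right; exists y; rewrite mem_rcons inE yp orbT.
  move: yp; rewrite mem_rcons inE => /predU1P[E|yp]; first by rewrite E ax in ay.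
  by right; exists y.
apply: is_maxU Hm Hb => S; split.
  case=> st [QS|[y [+ ay yS]]]; first by auto.
  rewrite mem_rcons inE => /predU1P[E|yp]; first by right; rewrite -E.
  by left; split=> //; right; exists y.
case=> [[st [QS|[y [yp ay yS]]]]|[st xS]]; split=> //; auto.
  by right; exists y; rewrite mem_rcons inE yp orbT.
by right; exists x; rewrite mem_rcons mem_head.
Qed.

Lemma best_nil (Q : {set 'I_n} -> Prop) (a : pred 'I_n) m :
  best c Q m ->
  best c (fun S => Q S \/ exists y, [/\ y \in [::], a y & y \in S]) m.
Proof. by apply: is_max_ext => S; split=> -[st]; [auto | case=> [|[y []]]]. Qed.

Lemma best_no_neighbour v p m : {in p, forall x, ~~ e v x} ->
  best c (fun=> True) m -> best c (fun S => misses v (mem p) S) m.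
Proof.
move=> no; apply: is_max_ext => S; split=> -[st _] //; split=> //.
by apply/missesP => x _ /no.
Qed.

(* The neighbours of [v] in [p] lie in the clique formed by [u] and its
   neighbours in [p1], of which a stable set contains at most one vertex. *)
Lemma best_parent v u p p1 p2 m : p = p1 ++ u :: p2 -> e v u ->
  {in p2, forall x, ~~ e v x} ->
  {in p &, forall x y, e v x -> e v y -> x != y -> e x y} ->
  {in p1 &, forall x y, e u x -> e u y -> x != y -> e x y} ->
  best c (fun S => (misses u (mem p1) S /\ u \notin S) \/
    exists y, [/\ y \in p1, e u y && ~~ e v y & y \in S]) m ->
  best c (fun S => misses v (mem p) S) m.
Proof.
move=> Ep evu no Nv Nu; apply: is_max_ext => S; split=> -[st H]; split=> //.
  apply/missesP => y yS /[dup] yp; rewrite [in X in X -> _]Ep mem_cat inE => yp'.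
  apply/negP => evy; case/or3P: yp' => [yp1|/eqP yu|/no/negP//]; last first.
    subst y; case: H => [[_ /negP//]|[x [xp1 /andP[eux _] xS]]].
    by move/stableP: st => /(_ u x yS xS) /negP.
  have yu : u != y.
    apply/eqP => uy; subst y; case: H => [[_ /negP//]|[x [xp1 /andP[eux _] xS]]].
    by move/stableP: st => /(_ u x yS xS) /negP.
  have euy : e u y by apply: Nv; rewrite // Ep mem_cat ?mem_head ?orbT // yp1.
  case: H => [[/missesP/(_ y yS yp1) /negP//]|[x [xp1 /andP[eux nevx] xS]]].
  move/stableP: st => /(_ x y xS yS) /negP[]; apply: Nu => //.
  by apply: contraNneq nevx => ->.
have uS : u \notin S.
  apply/negP => uS; move/missesP: H => /(_ u uS); rewrite evu.
  by rewrite Ep mem_cat mem_head orbT => /(_ isT).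
case: (boolP (misses u (mem p1) S)) => ms; first by left.
right; move: ms; rewrite negb_forall_in => /exists_inP[x xS].
rewrite negb_imply negbK => /andP[xp1 eux]; exists x; rewrite eux; split=> //=.
by move/missesP: H; apply; rewrite // Ep mem_cat xp1.
Qed.

Lemma best_notin v p m :
  best c (fun S => (misses v (mem p) S /\ v \notin S) \/
    exists y, [/\ y \in p, e v y & y \in S]) m ->
  best c (fun S => v \notin S) m.
Proof.
apply: is_max_ext => S; split=> -[st H]; split=> //.
  case: H => [[]//|[y [yp evy yS]]]; apply/negP => vS.
  by move/stableP: st => /(_ v y vS yS) /negP.
case: (boolP (misses v (mem p) S)) => ms; first by left.
right; move: ms; rewrite negb_forall_in => /exists_inP[x xS].
by rewrite negb_imply negbK => /andP[xp evx]; exists x.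
Qed.

End ClosedNeighbourhoods.

(** * Domains as penalties on the weights *)

Section Penalties.
Variables (w : 'I_n -> nat) (D : 'I_n -> {set bool}) (zlo : int).

(** One more than the total weight, so a single penalty outweighs any set. *)
Definition big_M : int := (\sum_i w i).+1%:Z.

(* Each violated domain costs [big_M], relative to the reference value [base],
   so that only compatible sets reach [base]. *)
Definition penalized i : int :=
  (w i)%:Z + (if false \in D i then 0 else big_M) - (if true \in D i then 0 else big_M).

Definition base : int := \sum_i (if false \in D i then 0 else big_M).

Lemma Posz_sum (I : finType) (A : pred I) (f : I -> nat) :
  (\sum_(i | A i) f i)%N%:Z = \sum_(i | A i) (f i)%:Z.
Proof. exact: (big_morph Posz PoszD erefl). Qed.

Lemma signed_weight_penalized S : signed_weight penalized S =
  (weight w S)%:Z + base - \sum_i (if (i \in S) \in D i then 0 else big_M).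
Proof.
rewrite /signed_weight /weight /base Posz_sum !(big_mkcond (fun i => i \in S)) /=.
rewrite -big_split -sumrB; apply: eq_bigr => i _ /=.
by rewrite /penalized; case: (i \in S); case: (true \in D i); case: (false \in D i) => /=; lia.
Qed.

Lemma weight_lt_big_M S : (weight w S)%:Z < big_M.
Proof.
by rewrite /big_M ltz_nat ltnS /weight big_mkcond leq_sum // => i _; case: ifP.
Qed.

Lemma signed_weight_compatible S :
  compatible D S -> signed_weight penalized S = (weight w S)%:Z + base.
Proof.
move=> /forallP co; rewrite signed_weight_penalized big1 ?subr0 // => i _.
by rewrite co.
Qed.

Lemma signed_weight_incompatible S :
  ~~ compatible D S -> signed_weight penalized S < base.
Proof.
rewrite negb_forall => /existsP[i ni]; rewrite signed_weight_penalized.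
rewrite (bigD1 i) //= (negPf ni); set t := \sum_(j | _) _.
have : 0 <= t by apply: sumr_ge0 => j _; case: ifP.
by have := weight_lt_big_M S; lia.
Qed.

(** The maximum with 0 keeps the threshold at [base] or above when [zlo] is negative, so that
    incompatible sets never reach it. Compatible sets are unaffected, their weights being
    nonnegative. *)
Definition threshold : int := base + Num.max 0 zlo.

Lemma threshold_le S : (threshold <= signed_weight penalized S) =
  compatible D S && (zlo <= (weight w S)%:Z).
Proof.
rewrite /threshold; have [co|/signed_weight_incompatible] := boolP (compatible D S).
  by rewrite signed_weight_compatible //=; lia.
by move=> /=; lia.
Qed.

(** The maximum is attained, so it reaches the threshold exactly when some set of the family
    does. *)
Lemma best_threshold (Q : {set 'I_n} -> Prop) (q : pred {set 'I_n}) m :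
  (forall S, Q S <-> q S) -> best penalized Q m ->
  (threshold <= m) = [exists S, [&& compatible D S, maxwis e w S zlo & q S]].
Proof.
move=> Qq [[S0 [st0 /Qq q0] <-] le].
apply/idP/existsP => [|[S /and3P[co /andP[st zl] /Qq QS]]].
  by rewrite threshold_le => /andP[co zl]; exists S0; rewrite co /maxwis st0 zl.
by apply: le_trans (le S _); rewrite // threshold_le co.
Qed.

Lemma best_consistent m : best penalized (fun=> True) m ->
  (threshold <= m) = consistent e w D zlo.
Proof.
move/(best_threshold (q := predT)) => -> //.
by apply: eq_existsb => S; rewrite andbT.
Qed.

Lemma best_filtered i a m : best penalized (fun S => (i \in S) = a) m ->
  (threshold <= m) = (a \in filtered e w D zlo i).
Proof.
move/(best_threshold (q := fun S => (i \in S) == a)) => -> //; last first.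
  by move=> S; split=> [->//|/eqP].
rewrite inE; apply/idP/andP => [ex|[]//]; split=> //.
by case/existsP: ex => S /and3P[/forallP/(_ i) co _ /eqP <-].
Qed.

(** An optimal set that reaches the threshold is compatible, hence also optimal among the compatible
    sets, whose signed weights exceed their weights by [base]. *)
Lemma best_zstar m : best penalized (fun=> True) m -> threshold <= m ->
  m - base = (zstar e w D)%:Z.
Proof.
move=> [[S0 [st0 _] E] le]; rewrite -E threshold_le => /andP[co _].
rewrite signed_weight_compatible // addrK /zstar; congr Posz.
apply/eqP; rewrite eqn_leq; apply/andP; split.
  by apply: (bigop.bigmax_sup S0); rewrite ?st0.
apply/bigmax_leqP => S /andP[st coS].
by have := le S (conj st I); rewrite -E !signed_weight_compatible // lerD2r lez_nat.
Qed.

End Penalties.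
End StableSets.

(** * Bounding the square of the number of vertices by cliques and edges *)

Section CliqueCover.
Variables (n : nat) (e : rel 'I_n).
Hypothesis e_irr : irreflexive e.

(** Adjacent ordered pairs are increasing or decreasing, and each of the two kinds injects into the
    edges, since an unordered pair together with its orientation determines the ordered one. *)
Lemma leq_adjacent_pairs :
  #|[set p : 'I_n * 'I_n | e p.1 p.2]| <= 2 * #|edges e|.
Proof.
pose A := [set p : 'I_n * 'I_n | e p.1 p.2 & p.1 < p.2].
pose B := [set p : 'I_n * 'I_n | e p.1 p.2 & p.2 < p.1].
have sub : [set p : 'I_n * 'I_n | e p.1 p.2] \subset A :|: B.
  apply/subsetP => -[i j]; rewrite !inE /= => eij; rewrite eij /=.
  by case: ltngtP => // /val_inj ij; rewrite ij e_irr in eij.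
have pair_inj (f : rel 'I_n) : (forall i j, f i j -> ~~ f j i) ->
    {in [set p : 'I_n * 'I_n | f p.1 p.2] &,
      injective (fun p : 'I_n * 'I_n => [set p.1; p.2])}.
  move=> asym [i j] [k l]; rewrite !inE /= => fij fkl E.
  have : k \in [set i; j] by rewrite E set21.
  have : l \in [set i; j] by rewrite E set22.
  rewrite !inE => /orP[]/eqP El /orP[]/eqP Ek; subst k l => //.
  - by have := asym _ _ fkl; rewrite fkl.
  - by have := asym _ _ fkl; rewrite fij.
  - by have := asym _ _ fkl; rewrite fkl.
have bound (f : rel 'I_n) : (forall i j, f i j -> ~~ f j i) ->
    (forall i j, f i j -> e i j) ->
    #|[set p : 'I_n * 'I_n | f p.1 p.2]| <= #|edges e|.
  move=> asym fe; rewrite -(card_in_imset (pair_inj f asym)) subset_leq_card //.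
  apply/subsetP => X /imsetP[[i j]]; rewrite inE /= => fij ->.
  by apply/imsetP; exists (i, j); rewrite // inE /= fe.
apply: leq_trans (subset_leq_card sub) (leq_trans (leq_card_setU _ _) _).
rewrite mul2n -addnn leq_add //.
  apply: (bound (fun i j => e i j && (i < j))) => i j /andP[] // _ ij.
  by rewrite negb_and -leqNgt ltnW ?orbT.
apply: (bound (fun i j => e i j && (j < i))) => i j /andP[] // _ ij.
by rewrite negb_and -leqNgt ltnW ?orbT.
Qed.

(** Cauchy-Schwarz against the constant 1: double the square, expand it, and bound each product by
    the sum of two squares. *)
Lemma sqrn_sum_leq (T : finType) (A : {set T}) (s : T -> nat) :
  (\sum_(x in A) s x) ^ 2 <= #|A| * \sum_(x in A) s x ^ 2.
Proof.
rewrite -(leq_pmul2l (isT : 0 < 2)) -mulnn big_distrlr /=.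
apply: (@leq_trans (\sum_(x in A) \sum_(y in A) (s x ^ 2 + s y ^ 2))).
  rewrite big_distrr leq_sum //= => x _; rewrite big_distrr leq_sum //= => y _.
  exact: nat_Cauchy.
under eq_bigr do rewrite big_split /= sum_nat_const.
by rewrite big_split /= -big_distrr /= sum_nat_const mul2n addnn.
Qed.

(* Choose a maximal clique around each vertex: two vertices with the same
   choice are equal or adjacent. *)
Lemma sqrn_leq_cliques_edges :
  n ^ 2 <= #|maximal_cliques e| * (2 * #|edges e| + n).
Proof.
have ex i : exists A, [&& A \in maximal_cliques e & i \in A].
  have cl : clique e [set i].
    apply/forall_inP => x /set1P ->; apply/forall_inP => y /set1P ->.
    by rewrite eqxx.
  have [A mA sA] := maxset_exists cl.
  by exists A; rewrite inE mA (subsetP sA) // set11.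
pose f i := xchoose (ex i); have fP i := xchooseP (ex i).
have fQ i : f i \in maximal_cliques e by case/andP: (fP i).
pose s Q := #|[set i | f i == Q]|.
have sum_s : \sum_(Q in maximal_cliques e) s Q = n.
  rewrite -[RHS]card_ord -sum1_card (partition_big f (mem (maximal_cliques e))) //=.
  by apply: eq_bigr => Q _; rewrite /s -sum1_card; apply: eq_bigl => i; rewrite inE.
rewrite -{1}sum_s; apply: leq_trans (sqrn_sum_leq _ _) _.
rewrite leq_mul2l; apply/orP; right.
pose same := [set p : 'I_n * 'I_n | f p.1 == f p.2].
(* Squared class sizes count the ordered pairs inside the classes. *)
have -> : \sum_(Q in maximal_cliques e) s Q ^ 2 = #|same|.
  rewrite -sum1_card.
  rewrite (partition_big (fun p : 'I_n * 'I_n => f p.1) (mem (maximal_cliques e))) //=.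
  apply: eq_bigr => Q _; rewrite /s -mulnn -cardsX -sum1_card.
  apply: eq_bigl => -[i j]; rewrite !inE /=.
  by apply/andP/andP => [[/eqP-> /eqP->]|[/eqP E /eqP<-]]; rewrite ?E ?eqxx.
have sub : same \subset [set p : 'I_n * 'I_n | e p.1 p.2] :|: [set (i, i) | i : 'I_n].
  apply/subsetP => -[i j]; rewrite !inE /= => /eqP E.
  have [ij|ij] := eqVneq i j; first by rewrite -ij imset_f ?orbT.
  have /andP[+ iA] := fP i; have /andP[_ jA] := fP j.
  rewrite inE => /maxsetp /forall_inP /(_ i iA) /forall_inP /(_ j).
  by rewrite -/(f i) E -/(f j) => /(_ jA); rewrite ij /= => ->.
apply: leq_trans (subset_leq_card sub) (leq_trans (leq_card_setU _ _) _).
by rewrite leq_add ?leq_adjacent_pairs // (leq_trans (leq_imset_card _ _)) ?card_ord.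
Qed.

End CliqueCover.

(** * Program logic *)

Section ProgramLogic.
Implicit Types (c : cmd) (s : state) (Q : state -> Prop).

(* The cost of a program in which every loop is iterated at most [n] times. *)
Fixpoint cost (n : nat) c : nat :=
  match c with
  | Skip => 1
  | Assign _ u => (ecost u).+1
  | Put _ k u => (ecost k + ecost u).+1
  | Seq c1 c2 => cost n c1 + cost n c2
  | If u v c1 c2 => (ecost u + ecost v + (cost n c1 + cost n c2)).+1
  | While u v c1 =>
      n * (ecost u + ecost v + cost n c1).+1 + (ecost u + ecost v).+1
  end.

Fixpoint written_vars c : seq nat :=
  match c with
  | Skip | Put _ _ _ => [::]
  | Assign x _ => [:: x]
  | Seq c1 c2 | If _ _ c1 c2 => written_vars c1 ++ written_vars c2
  | While _ _ c1 => written_vars c1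
  end.

Fixpoint written_arrs c : seq nat :=
  match c with
  | Skip | Assign _ _ => [::]
  | Put a _ _ => [:: a]
  | Seq c1 c2 | If _ _ c1 c2 => written_arrs c1 ++ written_arrs c2
  | While _ _ c1 => written_arrs c1
  end.

(** For a concrete program the membership conditions compute, so each use of a frame discharges them
    with [isT]. *)
Definition frame c s s' : Prop :=
  (forall x, x \notin written_vars c -> var s' x = var s x) /\
  (forall a, a \notin written_arrs c -> arr s' a = arr s a).

Lemma exec_frame c s t s' : exec c s t s' -> frame c s s'.
Proof.
elim=> {c s t s'} //=.
- by move=> x u s; split=> // y; rewrite inE => /negPf /= ->.
- by move=> a k u s; split=> // b; rewrite inE => /negPf /= ->.
- move=> c1 c2 s s1 s2 t1 t2 _ [v1 a1] _ [v2 a2]; split=> x /=;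
    rewrite mem_cat negb_or => /andP[n1 n2].
    by rewrite v2 ?v1.
  by rewrite a2 ?a1.
- move=> u v c1 c2 s s1 t _ _ [v1 a1]; split=> x /=;
    rewrite mem_cat negb_or => /andP[n1 n2]; [exact: v1|exact: a1].
- move=> u v c1 c2 s s1 t _ _ [v1 a1]; split=> x /=;
    rewrite mem_cat negb_or => /andP[n1 n2]; [exact: v1|exact: a1].
- move=> u v c s s1 s2 t1 t2 _ _ [v1 a1] _ [v2 a2]; split=> x /= nx.
    by rewrite v2 ?v1.
  by rewrite a2 ?a1.
Qed.

(** Total correctness together with the time bound. The bound depends only on [n] and the text of
    the program, so no postcondition has to mention time. *)
Definition wp (n : nat) c Q s : Prop :=
  exists t s', [/\ exec c s t s', t <= cost n c & Q s'].

(** The frame comes for free, so a specification need only describe what the program writes. *)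
Lemma wp_conseq n c Q Q' s :
  (forall s', Q' s' -> frame c s s' -> Q s') -> wp n c Q' s -> wp n c Q s.
Proof.
move=> QQ' [t [s' [ex le Qs']]]; exists t, s'; split=> //.
by apply: QQ' => //; apply: exec_frame ex.
Qed.

Lemma wp_skip n Q s : Q s -> wp n Skip Q s.
Proof. by move=> Qs; exists 1, s; split=> //; constructor. Qed.

Lemma wp_assign n x u Q s :
  Q (set_var s x (eval s u)) -> wp n (Assign x u) Q s.
Proof.
by move=> Qs; exists (ecost u).+1, (set_var s x (eval s u)); split=> //; constructor.
Qed.

Lemma wp_put n a k u Q s :
  Q (set_arr s a (eval s k) (eval s u)) -> wp n (Put a k u) Q s.
Proof. by move=> Qs; eexists _, _; split; [constructor| |exact: Qs]. Qed.

Lemma wp_seq n c1 c2 Q s : wp n c1 (wp n c2 Q) s -> wp n (Seq c1 c2) Q s.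
Proof.
move=> [t1 [s1 [ex1 le1 [t2 [s2 [ex2 le2 Qs2]]]]]].
exists (t1 + t2), s2; split=> //; first exact: ExecSeq ex1 ex2.
exact: leq_add.
Qed.

Lemma wp_if n u v c1 c2 Q s :
  ((eval s u <= eval s v)%R -> wp n c1 Q s) ->
  ((eval s v < eval s u)%R -> wp n c2 Q s) -> wp n (If u v c1 c2) Q s.
Proof.
move=> H1 H2; case: (lerP (eval s u) (eval s v)) => uv.
  have [t [s' [ex le Qs]]] := H1 uv.
  exists (ecost u + ecost v + t).+1, s'; split=> //; first exact: ExecIfTrue.
  by rewrite /= ltnS leq_add2l (leq_trans le) ?leq_addr.
have [t [s' [ex le Qs]]] := H2 uv.
exists (ecost u + ecost v + t).+1, s'; split=> //; first exact: ExecIfFalse.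
by rewrite /= ltnS leq_add2l (leq_trans le) ?leq_addl.
Qed.

(** Tests being of the form [<=], adding 1 makes this one strict. The counter is not initialised
    here, and [hi] is evaluated afresh before each pass. *)
Definition For (x : nat) (hi : expr) (body : cmd) : cmd :=
  While (Add (Var x) (Const 1)) hi
    (Seq body (Assign x (Add (Var x) (Const 1)))).

Lemma frame_refl c s : frame c s s. Proof. by []. Qed.

(** The bound [hi] has to keep its value under the writes of the loop itself, and [N <= m + n]
    limits the passes to the [n] that [cost n] pays for. *)
Lemma wp_for n x hi body (m N : nat) (I : nat -> state -> Prop) Q s :
  var s x = m%:Z%R -> m <= N <= m + n -> x \notin written_vars body ->
  (forall s1, frame (For x hi body) s s1 -> eval s1 hi = N%:Z%R) ->
  I m s ->
  (forall k s1, m <= k < N -> frame (For x hi body) s s1 ->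
     var s1 x = k%:Z%R -> I k s1 ->
     wp n body (fun s2 => I k.+1 (set_var s2 x k.+1%:Z%R)) s1) ->
  (forall s1, frame (For x hi body) s s1 -> I N s1 -> Q s1) ->
  wp n (For x hi body) Q s.
Proof.
move=> sx /andP[mN Nmn] xb hiN Im step fin.
(* [A] is the price of the final failing test and [B] that of one full pass; the induction is on the
   number [d] of passes left. *)
pose A := (ecost (Add (Var x) (Const 1)) + ecost hi).+1.
pose B := (ecost (Add (Var x) (Const 1)) + ecost hi +
  cost n (Seq body (Assign x (Add (Var x) (Const 1))))).+1.
have go d k s1 : k + d = N -> m <= k -> frame (For x hi body) s s1 ->
    var s1 x = k%:Z%R -> I k s1 ->
    exists t s', [/\ exec (For x hi body) s1 t s', t <= d * B + A & Q s'].
  elim: d k s1 => [|d IHd] k s1 kd mk fr s1x Ik.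
    exists A, s1; split=> //; last by apply: fin; rewrite // -kd addn0.
    by apply: ExecWhileFalse; rewrite hiN //= s1x; lia.
  have kN : m <= k < N by lia.
  have [t2 [s2 [ex2 le2 I2]]] := step k s1 kN fr s1x Ik.
  have s2x : var s2 x = k%:Z%R by rewrite -s1x; apply: (exec_frame ex2).1.
  have E2 : (eval s2 (Add (Var x) (Const 1)) = k.+1%:Z%R) by rewrite /= s2x; lia.
  have ex3 := ExecSeq ex2 (ExecAssign x (Add (Var x) (Const 1)) s2).
  rewrite E2 in ex3; set s3 := set_var _ _ _ in ex3 I2.
  have fr3 : frame (For x hi body) s s3.
    have [v3 a3] := exec_frame ex3.
    by split=> y ny; [rewrite v3 ?fr.1 | rewrite a3 ?fr.2].
  have kd' : k.+1 + d = N by lia.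
  have mk' : m <= k.+1 by lia.
  have s3x : var s3 x = k.+1%:Z%R by rewrite /= eqxx.
  have [t4 [s4 [ex4 le4 Q4]]] := IHd k.+1 s3 kd' mk' fr3 s3x I2.
  eexists _, s4; split; last exact: Q4.
    by refine (ExecWhileTrue _ ex3 ex4); rewrite hiN //= s1x; lia.
  apply: leq_trans (_ : (ecost (Add (Var x) (Const 1)) + ecost hi
    + (cost n body + (ecost (Add (Var x) (Const 1))).+1) + (d * B + A)).+1 <= _).
    by rewrite ltnS !leq_add.
  by rewrite mulSn /B -addSn addnA.
have [t [s' [ex le Qs']]] := go (N - m) m s (subnKC mN) (leqnn m) (frame_refl _ _) sx Im.
exists t, s'; split=> //; apply: leq_trans le _.
by rewrite -/A -/B [X in _ <= X](_ : _ = n * B + A) // leq_add2r leq_mul2r; lia.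
Qed.

End ProgramLogic.

(** * The algorithm *)

Declare Scope cmd_scope.
Notation "x ::= u" := (Assign x u) (at level 70) : cmd_scope.
Notation "c1 ;; c2" := (Seq c1 c2) (at level 75, right associativity) : cmd_scope.

Notation vI := 4 (only parsing).
Notation vJ := 5 (only parsing).
Notation vRow := 6 (only parsing).
Notation vM := 7 (only parsing).
Notation vBase := 8 (only parsing).
Notation vX := 9 (only parsing).
Notation vK := 10 (only parsing).
Notation vBest := 11 (only parsing).
Notation vB := 12 (only parsing).
Notation vTot := 13 (only parsing).
Notation vV := 14 (only parsing).
Notation vD := 15 (only parsing).
Notation vThr := 16 (only parsing).
Notation vT := 17 (only parsing).
Notation vU := 18 (only parsing).
Notation vW := 19 (only parsing).
Notation vR := 20 (only parsing).
Notation vZ := 21 (only parsing).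

(* Cell [aRow i + j] of [aMat] tells whether i and j are adjacent. [aOrd] is the
   visit order, [aCnt] counts the visited neighbours, [aC] holds the residual
   weights.  At position k of the visit order, [aIn] holds the maximum weight of
   a stable set containing the vertex, and [aMiss] that of a stable set missing
   the vertex and its earlier neighbours. *)
Notation aRow := 5 (only parsing).
Notation aMat := 6 (only parsing).
Notation aCnt := 7 (only parsing).
Notation aVis := 8 (only parsing).
Notation aOrd := 9 (only parsing).
Notation aC := 10 (only parsing).
Notation aIn := 11 (only parsing).
Notation aMiss := 12 (only parsing).

Section Programs.
Local Open Scope cmd_scope.

(** Without multiplication, the start of each row is obtained by repeated addition of [n] and stored
    in [aRow]. *)
Definition build_matrix : cmd :=
  vRow ::= Const 0 ;;
  vI ::= Const 0 ;;
  For vI (Var var_n) (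
    vJ ::= Get arr_offset (Var vI) ;;
    For vJ (Get arr_offset (Add (Var vI) (Const 1)))
      (Put aMat (Add (Var vRow) (Get arr_adj (Var vJ))) (Const 1)) ;;
    Put aRow (Var vI) (Var vRow) ;;
    vRow ::= Add (Var vRow) (Var var_n)).

Definition build_weights : cmd :=
  vM ::= Const 1 ;;
  vI ::= Const 0 ;;
  For vI (Var var_n) (vM ::= Add (Var vM) (Get arr_weight (Var vI))) ;;
  vBase ::= Const 0 ;;
  vI ::= Const 0 ;;
  For vI (Var var_n) (
    vX ::= Get arr_weight (Var vI) ;;
    If (Get (arr_dom false) (Var vI)) (Const 0)
      (vX ::= Add (Var vX) (Var vM) ;; vBase ::= Add (Var vBase) (Var vM)) Skip ;;
    If (Get (arr_dom true) (Var vI)) (Const 0)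
      (vX ::= Defs.Sub (Var vX) (Var vM)) Skip ;;
    Put aC (Var vI) (Var vX)).

Definition Adj (x y : expr) : expr := Get aMat (Add (Get aRow x) y).

(** The initial value -1 lets the first unvisited vertex be chosen even if it has no visited
    neighbour. *)
Definition pick_vertex : cmd :=
  vBest ::= Const (-1)%R ;;
  vB ::= Const 0 ;;
  vI ::= Const 0 ;;
  For vI (Var var_n) (
    If (Get aVis (Var vI)) (Const 0)
      (If (Add (Var vBest) (Const 1)) (Get aCnt (Var vI))
        (vBest ::= Get aCnt (Var vI) ;; vB ::= Var vI) Skip) Skip).

Definition search : cmd :=
  vK ::= Const 0 ;;
  For vK (Var var_n) (
    pick_vertex ;;
    Put aOrd (Var vK) (Var vB) ;;
    Put aVis (Var vB) (Const 1) ;;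
    vI ::= Const 0 ;;
    For vI (Var var_n)
      (Put aCnt (Var vI) (Add (Get aCnt (Var vI)) (Adj (Var vB) (Var vI))))).

(** While [vI] counts up, [vK] runs backwards through the visit order, and [vD] is the positive part
    of the residual weight. *)
Definition eliminate : cmd :=
  vTot ::= Const 0 ;;
  vI ::= Const 0 ;;
  For vI (Var var_n) (
    vK ::= Defs.Sub (Defs.Sub (Var var_n) (Const 1)) (Var vI) ;;
    vV ::= Get aOrd (Var vK) ;;
    vD ::= Get aC (Var vV) ;;
    If (Var vD) (Const 0) (vD ::= Const 0) Skip ;;
    vTot ::= Add (Var vTot) (Var vD) ;;
    vJ ::= Const 0 ;;
    For vJ (Var vK) (
      If (Const 1) (Adj (Var vV) (Get aOrd (Var vJ)))
        (Put aC (Get aOrd (Var vJ)) (Defs.Sub (Get aC (Get aOrd (Var vJ))) (Var vD)))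
        Skip)).

(** Each hit overwrites the previous one, which leaves the position of the last visited earlier
    neighbour, or -1 if there is none. *)
Definition find_parent : cmd :=
  vU ::= Const (-1)%R ;;
  vJ ::= Const 0 ;;
  For vJ (Var vK)
    (If (Const 1) (Adj (Var vV) (Get aOrd (Var vJ))) (vU ::= Var vJ) Skip).

(** Leaves in [vT] the optimum over the stable sets missing the earlier neighbours of the current
    vertex, obtained through its parent [u]. *)
Definition avoid_later : cmd :=
  find_parent ;;
  vT ::= Var vTot ;;
  If (Const 0) (Var vU) (
    vT ::= Get aMiss (Var vU) ;;
    vW ::= Get aOrd (Var vU) ;;
    vJ ::= Const 0 ;;
    For vJ (Var vU)
      (If (Const 1) (Adj (Var vW) (Get aOrd (Var vJ)))
        (If (Adj (Var vV) (Get aOrd (Var vJ))) (Const 0)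
          (If (Var vT) (Get aIn (Var vJ)) (vT ::= Get aIn (Var vJ)) Skip)
          Skip)
        Skip)) Skip.

Definition avoid_vertex : cmd :=
  vZ ::= Get aMiss (Var vK) ;;
  vJ ::= Const 0 ;;
  For vJ (Var vK)
    (If (Const 1) (Adj (Var vV) (Get aOrd (Var vJ)))
      (If (Var vZ) (Get aIn (Var vJ)) (vZ ::= Get aIn (Var vJ)) Skip)
      Skip).

Definition filter_domains : cmd :=
  vK ::= Const 0 ;;
  For vK (Var var_n) (
    vV ::= Get aOrd (Var vK) ;;
    avoid_later ;;
    vR ::= Get aC (Var vV) ;;
    If (Var vR) (Const 0)
      (Put aIn (Var vK) (Add (Var vT) (Var vR)) ;; Put aMiss (Var vK) (Var vT))
      (Put aIn (Var vK) (Var vT) ;;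
       Put aMiss (Var vK) (Defs.Sub (Var vT) (Var vR))) ;;
    avoid_vertex ;;
    If (Var vThr) (Get aIn (Var vK))
      (Put (arr_dom true) (Var vV) (Const 1))
      (Put (arr_dom true) (Var vV) (Const 0)) ;;
    If (Var vThr) (Var vZ)
      (Put (arr_dom false) (Var vV) (Const 1))
      (Put (arr_dom false) (Var vV) (Const 0))).

End Programs.

Lemma big_ord_ltS (R : Type) (idx : R) (op : Monoid.com_law idx) (n : nat) (F : 'I_n -> R)
    (k : 'I_n) :
  \big[op/idx]_(i < n | i < k.+1) F i = op (\big[op/idx]_(i < n | i < k) F i) (F k).
Proof.
rewrite (bigD1 k) //= Monoid.mulmC; congr (op _ _); apply: eq_bigl => i.
by rewrite ltnS leq_eqVlt (inj_eq val_inj) andb_orl andbN /= andb_idr // => /ltn_eqF/negbT.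
Qed.

Lemma ltn_ordS (n : nat) (v i : 'I_n) : i < v.+1 -> i = v \/ i < v.
Proof. by rewrite ltnS leq_eqVlt val_eqE => /predU1P. Qed.

(** * Correctness of the adjacency matrix and of the weights *)

Section Correctness.
Variables (n : nat) (e : rel 'I_n) (adj : 'I_n -> seq 'I_n).
Hypotheses (e_sym : symmetric e) (e_irr : irreflexive e).
Hypothesis adjP : adjacency_lists e adj.
Local Notation wp := (wp n).

Definition offset (k : nat) : nat := \sum_(i < n | i < k) size (adj i).

Lemma offsetS (k : 'I_n) : offset k.+1 = offset k + size (adj k).
Proof. exact: (big_ord_ltS addn). Qed.

Lemma size_adj (i : 'I_n) : size (adj i) <= n.
Proof. by rewrite -(card_uniqP (adjP i).1) -[X in _ <= X]card_ord max_card. Qed.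

Lemma offset_size (k : nat) :
  offset k = size (flatten [seq adj i | i <- take k (enum 'I_n)]).
Proof.
rewrite size_flatten /shape -map_comp sumnE big_map.
have <- : [seq i : 'I_n <- enum 'I_n | i < k] = take k (enum 'I_n).
  apply: (inj_map val_inj); rewrite map_take val_enum_ord.
  rewrite -(filter_map val (fun i => i < k)) val_enum_ord.
  have [kn|nk] := leqP k n; first by rewrite take_iota (minn_idPl kn) (filter_iota_ltn 0).
  rewrite take_oversize ?size_iota 1?ltnW //; apply/all_filterP/allP => i.
  by rewrite mem_iota => /andP[_ /ltn_trans]; apply.
by rewrite big_filter big_enum_cond.
Qed.

Lemma nth_adjacency (k : 'I_n) (t : nat) (j0 : 'I_n) : t < size (adj k) ->
  nth 0%R [seq (nat_of_ord j)%:Z%R | j <- flatten [seq adj i | i <- enum 'I_n]]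
    (offset k + t) = (nth j0 (adj k) t : nat)%:Z%R.
Proof.
move=> tk.
have Ee : enum 'I_n = take k (enum 'I_n) ++ k :: drop k.+1 (enum 'I_n).
  by rewrite -[X in _ ++ X :: _](nth_ord_enum k k) -drop_nth ?size_enum_ord // cat_take_drop.
have Ef : flatten [seq adj i | i <- enum 'I_n] =
    flatten [seq adj i | i <- take k (enum 'I_n)] ++
    (adj k ++ flatten [seq adj i | i <- drop k.+1 (enum 'I_n)]).
  by rewrite {1}Ee map_cat flatten_cat.
rewrite (nth_map j0) Ef; last by rewrite !size_cat -offset_size; lia.
by rewrite nth_cat -offset_size ltnNge leq_addr /= addKn nth_cat tk.
Qed.

Definition matrix_of s : Prop := forall i j : 'I_n,
  arr s aMat (arr s aRow (i : nat)%:Z + (j : nat)%:Z)%R = (e i j : nat)%:Z%R.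

Local Open Scope ring_scope.

Definition adjacency_input s : Prop :=
  [/\ var s var_n = n%:Z,
      forall k, (k <= n)%N -> arr s arr_offset k%:Z = (offset k)%:Z,
      forall (k j0 : 'I_n) t, (t < size (adj k))%N ->
        arr s arr_adj (offset k + t)%N%:Z = (nth j0 (adj k) t : nat)%:Z &
      forall k, arr s aMat k = 0].

(** Quotient and remainder by [n] recover the row and the column. *)
Lemma cell_inj (i i' j j' : 'I_n) :
  ((i * n + j)%N == (i' * n + j')%N) = (i == i') && (j == j').
Proof.
apply/eqP/andP => [E|[/eqP-> /eqP->]//].
have n0 : (0 < n)%N by apply: leq_trans (ltn_ord i).
split; apply/eqP/val_inj.
  by have := congr1 (divn^~ n) E; rewrite !divnMDl // !divn_small // !addn0.
by have := congr1 (modn^~ n) E; rewrite !modnMDl !modn_small.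
Qed.

Lemma wp_build_matrix s : adjacency_input s -> wp build_matrix matrix_of s.
Proof.
move=> [sn soff sadj smat].
apply: wp_seq; apply: wp_assign; apply: wp_seq; apply: wp_assign.
set s0 := set_var _ _ _.
apply: (@wp_for _ _ _ _ 0 n (fun k s1 =>
  [/\ var s1 vRow = (k * n)%N%:Z,
      forall i : 'I_n, (i < k)%N -> arr s1 aRow (i : nat)%:Z = (i * n)%N%:Z &
      forall i j : 'I_n,
        arr s1 aMat (i * n + j)%N%:Z = ((i < k)%N && e i j : nat)%:Z])) => //=.
- by move=> s1 [fv _]; rewrite (fv var_n isT).
- move=> k s1 kn [fv fa] s1I [Irow Irows Imat]; rewrite /= in fv fa.
  apply: wp_seq; apply: wp_assign; apply: wp_seq => /=.
  have Eoff k' : (k' <= n)%N -> arr s1 arr_offset k'%:Z = (offset k')%:Z.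
    by move=> k'n; rewrite (fa arr_offset isT) /= soff.
  rewrite s1I Eoff ?(ltnW kn) //; pose v := Ordinal kn.
  (* Once the cells before [p] are read, row [v] marks the first [p - offset k] entries of its
     adjacency list. *)
  apply: (@wp_for _ _ _ _ (offset k) (offset k.+1) (fun p s2 =>
    forall i j : 'I_n, arr s2 aMat (i * n + j)%N%:Z =
      (((i < k)%N && e i j) ||
       ((i == v) && (j \in take (p - offset k)%N (adj v))) : nat)%:Z)) => //=.
  + by rewrite (offsetS v) leq_addr leq_add2l size_adj.
  + move=> s2 [gv ga]; rewrite (gv vI isT) (ga arr_offset isT) /= s1I.
    by rewrite -Eoff //; congr arr; lia.
  + by move=> i j; rewrite Imat subnn take0 in_nil andbF orbF.
  + move=> p s2 /andP[op po] [gv ga] s2J IH; rewrite /= in gv ga.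
    apply: wp_put => i j /=.
    rewrite s2J (gv vRow isT) (ga arr_adj isT) (fa arr_adj isT) /= Irow.
    have tk : (p - offset k < size (adj v))%N by move: po; rewrite (offsetS v) /=; lia.
    have := sadj v v _ tk; rewrite /= subnKC // => ->.
    rewrite -PoszD eqz_nat IH -[(k * n)%N]/(v * n)%N cell_inj.
    rewrite subSn // (take_nth v) // mem_rcons in_cons.
    by case: (i =P v) => //= ->; rewrite ltnn /=; case: eqP.
  move=> s2 [gv ga] I2; rewrite /= in gv ga.
  apply: wp_seq; apply: wp_put; apply: wp_assign; split=> /=.
  + rewrite (gv vRow isT) (gv var_n isT) /= Irow (fv var_n isT) /= sn; lia.
  + move=> i ik; rewrite (gv vI isT) (gv vRow isT) (ga aRow isT) /= s1I Irow eqz_nat.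
    case: eqP => [->//|ni]; apply: Irows; lia.
  + move=> i j; rewrite I2 (offsetS v) addKn take_size (adjP v).2.
    rewrite unfold_in; case: (eqVneq i v) => [->|iv] /=.
      by rewrite ltnn leqnn.
    by rewrite orbF ltnS [in RHS]leq_eqVlt -[k]/(nat_of_ord v) val_eqE (negPf iv).
- move=> s1 [fv fa] [Irow Irows Imat] i j.
  by rewrite Irows // -PoszD Imat ltn_ord.
Qed.

Section Weights.
Variables (w : 'I_n -> nat) (D : 'I_n -> {set bool}).

Definition constraint_input s : Prop :=
  [/\ var s var_n = n%:Z,
      forall i : 'I_n, arr s arr_weight (i : nat)%:Z = (w i)%:Z,
      forall i : 'I_n, arr s (arr_dom false) (i : nat)%:Z = (false \in D i : nat)%:Z &
      forall i : 'I_n, arr s (arr_dom true) (i : nat)%:Z = (true \in D i : nat)%:Z].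

Lemma wp_build_weights s : constraint_input s ->
  wp build_weights (fun s' => var s' vBase = base w D /\
    forall i : 'I_n, arr s' aC (i : nat)%:Z = penalized w D i) s.
Proof.
move=> [sn sw s0 s1].
apply: wp_seq; apply: wp_assign; apply: wp_seq; apply: wp_assign; apply: wp_seq.
apply: (@wp_for _ _ _ _ 0 n (fun k s' =>
  var s' vM = (\sum_(i < n | (i < k)%N) w i).+1%:Z)) => //=.
- by move=> s' [fv _]; rewrite (fv var_n isT).
- by rewrite big1.
- move=> k s' kn [fv fa] sI IH; apply: wp_assign => /=.
  rewrite IH sI (fa arr_weight isT) /= (sw (Ordinal kn)).
  by rewrite (big_ord_ltS addn _ (Ordinal kn)) /=; lia.
move=> s' [fv fa] sM; rewrite /= in fv fa.
have {}sM : var s' vM = big_M w.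
  by rewrite sM /big_M; congr (_.+1%:Z); apply: eq_bigl => i; rewrite ltn_ord.
apply: wp_seq; apply: wp_assign; apply: wp_seq; apply: wp_assign.
apply: (@wp_for _ _ _ _ 0 n (fun k s2 =>
  var s2 vBase = \sum_(i < n | (i < k)%N) (if false \in D i then 0 else big_M w) /\
  forall i : 'I_n, (i < k)%N -> arr s2 aC (i : nat)%:Z = penalized w D i)) => //=.
- by move=> s2 [gv _]; rewrite (gv var_n isT) /= (fv var_n isT).
- by rewrite big1.
- move=> k s2 kn [gv ga] sI [IB IC]; rewrite /= in gv ga.
  pose v := Ordinal kn.
  have Ew : arr s2 arr_weight k%:Z = (w v)%:Z.
    by rewrite (ga arr_weight isT) /= (fa arr_weight isT) (sw v).
  have E0 : arr s2 (arr_dom false) k%:Z = (false \in D v : nat)%:Z.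
    by rewrite (ga (arr_dom false) isT) /= (fa (arr_dom false) isT) (s0 v).
  have E1 : arr s2 (arr_dom true) k%:Z = (true \in D v : nat)%:Z.
    by rewrite (ga (arr_dom true) isT) /= (fa (arr_dom true) isT) (s1 v).
  have EM : var s2 vM = big_M w by rewrite (gv vM isT).
  rewrite (big_ord_ltS +%R _ v) /=.
  have fin x : x = penalized w D v -> forall i : 'I_n, (i < k.+1)%N ->
      (if (i : nat)%:Z == k%:Z then x else arr s2 aC (i : nat)%:Z) = penalized w D i.
    move=> -> i ik; rewrite eqz_nat -[k]/(nat_of_ord v) val_eqE.
    by case: eqVneq => [->|iv] //; apply: IC; move: iv; rewrite -val_eqE /=; lia.
  apply: wp_seq; apply: wp_assign; apply: wp_seq.
  apply: wp_if => /= c0; [apply: wp_seq; do 2 apply: wp_assign | apply: wp_skip];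
    (apply: wp_seq; apply: wp_if => /= c1; [apply: wp_assign | apply: wp_skip]);
    apply: wp_put; move: c0 c1; rewrite /= ?sI ?E0 ?E1 ?EM IB Ew;
    case D0 : (false \in D v) => // _; case D1 : (true \in D v) => // _;
    split; rewrite ?addr0 //; apply: fin; rewrite /penalized D0 D1; lia.
move=> s2 [gv ga] [sB sC]; split=> [|i]; last exact: sC.
by rewrite sB; apply: eq_bigl => i; rewrite ltn_ord.
Qed.

End Weights.

(** * Correctness of the search *)

Implicit Type o : seq 'I_n.

Definition ordered o s : Prop := forall v0 t, (t < size o)%N ->
  arr s aOrd t%:Z = (nth v0 o t : nat)%:Z.

Definition search_marks o s : Prop := forall i : 'I_n,
  arr s aVis (i : nat)%:Z = (i \in o : nat)%:Z /\
  arr s aCnt (i : nat)%:Z = (count (e i) o)%:Z.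

Lemma wp_pick_vertex o s : var s var_n = n%:Z -> (size o < n)%N ->
  search_marks o s ->
  wp pick_vertex (fun s' => exists b : 'I_n, [/\ var s' vB = (b : nat)%:Z, b \notin o &
    forall c, c \notin o -> (count (e c) o <= count (e b) o)%N]) s.
Proof.
move=> sn on marks.
apply: wp_seq; apply: wp_assign; apply: wp_seq; apply: wp_assign.
apply: wp_seq; apply: wp_assign.
apply: (@wp_for _ _ _ _ 0 n (fun k s' =>
  (var s' vBest = -1 /\ forall i : 'I_n, (i < k)%N -> i \in o) \/
  exists b : 'I_n, [/\ var s' vB = (b : nat)%:Z, b \notin o,
    var s' vBest = (count (e b) o)%:Z &
    forall c : 'I_n, (c < k)%N -> c \notin o -> (count (e c) o <= count (e b) o)%N])) => //=.
- by move=> s' [fv _]; rewrite (fv var_n isT).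
- by left.
- move=> k s' kn [fv fa] sI IH; rewrite /= in fv fa.
  pose v := Ordinal kn; have [Ev Ec] := marks v; rewrite /= in Ev Ec.
  apply: wp_if => /=; rewrite sI (fa aVis isT) /= Ev => vis.
    have vo : v \notin o by case: (v \in o) vis.
    apply: wp_if => /=; rewrite sI (fa aCnt isT) /= Ec => cmp.
      apply: wp_seq; do 2 apply: wp_assign; right; exists v; split=> //=.
        by rewrite sI (fa aCnt isT) /= Ec.
      move=> c /(@ltn_ordS _ v)[-> //|ck] co.
      case: IH => [[_ /(_ c ck)]|[b [_ _ Eb le]]]; first by rewrite (negPf co).
      by apply: leq_trans (le c ck co) _; move: cmp; rewrite Eb; lia.
    apply: wp_skip; right; case: IH => [[E _]|[b [EB bo Eb le]]].
      by move: cmp; rewrite E; lia.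
    exists b; split=> // c /(@ltn_ordS _ v)[-> _|ck]; last exact: le.
    by move: cmp; rewrite Eb; lia.
  have vo : v \in o by case: (v \in o) vis.
  apply: wp_skip; case: IH => [[E IH]|[b [EB bo Eb le]]]; [left|right].
    by split=> // i /(@ltn_ordS _ v)[->|]; last exact: IH.
  by exists b; split=> // c /(@ltn_ordS _ v)[->|ck]; [rewrite vo | apply: le].
(* Had no candidate been found, every vertex would be in [o], which has fewer than [n] entries. *)
move=> s' _ [[_ all_o]|[b [EB bo _ le]]]; last by exists b; split=> // c; apply: le.
have : (#|'I_n| <= #|o|)%N by apply/subset_leq_card/subsetP => i _; apply: all_o.
by rewrite card_ord => /leq_trans/(_ (card_size o)); rewrite leqNgt on.
Qed.

Lemma wp_search s : var s var_n = n%:Z -> matrix_of s ->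
  (forall k, arr s aVis k = 0) -> (forall k, arr s aCnt k = 0) ->
  wp search (fun s' => exists o,
    [/\ uniq o, size o = n, cardinality_search e o & ordered o s']) s.
Proof.
move=> sn smat svis scnt; apply: wp_seq; apply: wp_assign.
apply: (@wp_for _ _ _ _ 0 n (fun k s' => exists o,
    [/\ uniq o, size o = k, cardinality_search e o, ordered o s' & search_marks o s'])) => //=.
- by move=> s' [fv _]; rewrite (fv var_n isT).
- exists [::]; split=> // [|i]; first exact: cardinality_search_nil.
  by rewrite svis scnt.
- move=> k s1 kn [fv fa] sK [o [uo so co oo mo]]; rewrite /= in fv fa.
  have s1n : var s1 var_n = n%:Z by rewrite (fv var_n isT).
  apply: wp_seq; have on : (size o < n)%N by rewrite so.
  apply: wp_conseq (wp_pick_vertex s1n on mo) => s2 [b [s2b bo bmax]] [gv ga].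
  rewrite /= in gv ga.
  apply: wp_seq; apply: wp_put; apply: wp_seq; apply: wp_put; apply: wp_seq; apply: wp_assign.
  apply: (@wp_for _ _ _ _ 0 n (fun m s3 => forall i : 'I_n,
    arr s3 aCnt (i : nat)%:Z = (count (e i) o + ((i < m)%N && e b i))%N%:Z)) => //=.
  + by move=> s3 [hv _]; rewrite (hv var_n isT) /= (gv var_n isT).
  + by move=> i; rewrite (ga aCnt isT) addn0; case: (mo i).
  + move=> m s3 mn [hv ha] sI IH; rewrite /= in hv ha.
    apply: wp_put => i /=; rewrite sI (hv vB isT) /= s2b.
    rewrite (ha aRow isT) (ha aMat isT) /= (ga aRow isT) (ga aMat isT).
    rewrite (fa aRow isT) (fa aMat isT) /= (smat b (Ordinal mn)).
    rewrite (IH (Ordinal mn)) /= ltnn addn0 eqz_nat IH.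
    case: eqP => [im|im].
      by rewrite im ltnSn (_ : i = Ordinal mn) //; apply: val_inj.
    by congr (_ + (_ && _))%N%:Z; lia.
  move=> s3 [hv ha] I3; rewrite /= in hv ha; exists (rcons o b); split.
  + by rewrite rcons_uniq bo.
  + by rewrite size_rcons so.
  + exact: cardinality_search_rcons.
  + move=> v0 t; rewrite size_rcons ltnS leq_eqVlt nth_rcons so => tk.
    rewrite /= (ha aOrd isT) /= (gv vK isT) sK eqz_nat.
    case: eqP tk => [-> _|_ /= tk]; first by rewrite ltnn s2b.
    by rewrite tk (ga aOrd isT) (oo v0) ?so.
  + move=> i; rewrite /= (ha aVis isT) /= I3 ltn_ord /= mem_rcons in_cons.
    rewrite -cats1 count_cat /= addn0 (e_sym b); split=> //.
    rewrite s2b eqz_nat (inj_eq val_inj) (ga aVis isT).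
    by case: eqP => //= _; case: (mo i).
by move=> s' _ [o [uo so co oo _]]; exists o.
Qed.

(** * Correctness of the elimination and of the scans *)

Section Elimination.
Variables (o : seq 'I_n) (c : 'I_n -> int).
Hypotheses (o_uniq : uniq o) (o_size : size o = n) (o_peo : reverse_peo e o).

(** All that the filtering pass needs from the elimination: the residual weight of [v] at its own
    elimination turns an optimum over the sets missing its earlier neighbours into the two optima
    with and without [v]. *)
Definition residual_spec (p : seq 'I_n) (v : 'I_n) (rho : int) : Prop :=
  forall M, best e c (fun S => misses e v (mem p) S) M ->
    best e c (fun S => misses e v (mem p) S /\ v \in S) (M + Num.min rho 0) /\
    best e c (fun S => misses e v (mem p) S /\ v \notin S) (M - Num.max rho 0).

Lemma split_order k v0 : (k < n)%N ->
  o = take k o ++ nth v0 o k :: drop k.+1 o.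
Proof. by move=> kn; rewrite -drop_nth ?o_size // cat_take_drop. Qed.

Lemma nth_notin_take j k v0 : (j < n)%N -> (k <= j)%N -> nth v0 o j \notin take k o.
Proof.
move=> jn kj; rewrite in_take_leq ?o_size ?index_uniq ?o_size // -?leqNgt //.
by rewrite (leq_trans kj) // ltnW.
Qed.

(** Passing from the first [k.+1] visited vertices to the first [k] removes [v], whose neighbours
    among the latter form a clique by [o_peo]. *)
Lemma eliminated_take k v0 D r (v := nth v0 o k) (d := Num.max (r v) 0) :
  (k < n)%N -> eliminated e c [set x in take k.+1 o] D r ->
  eliminated e c [set x in take k o] (D + d)
    (fun x => if (x \in take k o) && e v x then r x - d else r x) /\
  residual_spec (take k o) v (r v).
Proof.
move=> kn; rewrite (take_nth v0) ?o_size //.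
have -> : [set x in rcons (take k o) v] = v |: [set x in take k o].
  by apply/setP => x; rewrite !inE mem_rcons.
have vP : v \notin [set x in take k o] by rewrite inE nth_notin_take.
have Nv : {in [set x in take k o] &, forall x y, e v x -> e v y -> x != y -> e x y}.
  by move=> x y; rewrite !inE => xp yp; apply: (o_peo (split_order v0 kn) xp yp).
move=> el; split.
  by apply: eq_eliminated (eliminated_step e_sym e_irr vP Nv el) => x; rewrite /reduced !inE.
have ms S : misses e v (mem (take k o)) S = misses e v (mem [set x in take k o]) S.
  by apply: eq_forallb => x; rewrite [in RHS]inE.
move=> M bM; have {}bM : best e c (fun S => misses e v (mem [set x in take k o]) S) M.
  by apply: is_max_ext bM => S; rewrite ms.
split.
  by apply: is_max_ext (best_in e_sym e_irr vP Nv el bM) => S; rewrite ms.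
by apply: is_max_ext (best_out e_sym e_irr vP Nv el bM) => S; rewrite ms.
Qed.

Lemma wp_eliminate s : var s var_n = n%:Z -> matrix_of s -> ordered o s ->
  (forall i : 'I_n, arr s aC (i : nat)%:Z = c i) ->
  wp eliminate (fun s' => best e c (fun=> True) (var s' vTot) /\
    forall k v0 (v := nth v0 o k), (k < n)%N ->
      residual_spec (take k o) v (arr s' aC (v : nat)%:Z)) s.
Proof.
move=> sn smat sord sc; apply: wp_seq; apply: wp_assign; apply: wp_seq; apply: wp_assign.
(* After [t] passes the vertices from position [n - t] on are eliminated. *)
apply: (@wp_for _ _ _ _ 0 n (fun t s' => exists r,
    [/\ eliminated e c [set x in take (n - t) o] (var s' vTot) r,
        forall i : 'I_n, arr s' aC (i : nat)%:Z = r i &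
        forall k v0 (v := nth v0 o k), (n - t <= k < n)%N ->
          residual_spec (take k o) v (r v)])) => //=.
- by move=> s' [fv _]; rewrite (fv var_n isT).
- exists c; split=> // [|k v0 v]; last by lia.
  rewrite subn0 take_oversize ?o_size //; have -> : [set x in o] = setT.
    apply/eqP; rewrite eqEcard subsetT cardsT card_ord /= cardsE.
    by rewrite (card_uniqP o_uniq) o_size.
  exact: eliminated_setT.
- move=> t s1 tn [fv fa] sI [r [el Cr res]]; rewrite /= in fv fa.
  pose v0 := Ordinal tn; pose k := (n - t).-1.
  have kn : (k < n)%N by rewrite /k; lia.
  have nk : (n - t)%N = k.+1 by rewrite /k; lia.
  pose v := nth v0 o k; pose d := Num.max (r v) 0.
  have ord j : (j < n)%N -> arr s1 aOrd j%:Z = (nth v0 o j : nat)%:Z.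
    by move=> jn; rewrite (fa aOrd isT) /= (sord v0) ?o_size.
  rewrite nk in el.
  have [el' res'] := @eliminated_take k v0 _ _ kn el.
  have Ek : n%:Z - 1 - t%:Z = k%:Z by rewrite /k; lia.
  apply: wp_seq; apply: wp_assign; apply: wp_seq; apply: wp_assign.
  apply: wp_seq; apply: wp_assign; apply: wp_seq => /=.
  rewrite sI (fv var_n isT) /= sn Ek ord // Cr -/v.
  pose Q s2 := [/\ var s2 vD = d, var s2 vV = (v : nat)%:Z, var s2 vK = k%:Z,
    var s2 vTot = var s1 vTot & arr s2 = arr s1].
  apply: (@wp_conseq _ _ _ Q).
    move=> s2 [s2D s2V s2K s2T Ea] [gv _]; rewrite /= in gv.
    apply: wp_seq; apply: wp_assign; apply: wp_seq; apply: wp_assign => /=.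
    rewrite s2D s2T.
    apply: (@wp_for _ _ _ _ 0 k (fun m s3 => forall i : 'I_n,
      arr s3 aC (i : nat)%:Z = if (i \in take m o) && e v i then r i - d else r i)) => //=.
    + by rewrite ltnW.
    + by move=> s3 [hv _]; rewrite (hv vK isT).
    + by move=> i; rewrite Ea take0.
    + move=> m s3 mk [hv ha] sJ IH; rewrite /= in hv ha.
      pose x := nth v0 o m.
      have mn : (m < n)%N by apply: ltn_trans kn.
      have Ex : arr s3 aOrd m%:Z = (x : nat)%:Z by rewrite (ha aOrd isT) /= Ea ord.
      have xm : x \notin take m o by apply: nth_notin_take.
      have Ev : arr s3 aMat (arr s3 aRow (v : nat)%:Z + (x : nat)%:Z) = (e v x : nat)%:Z.
        rewrite (ha aMat isT) (ha aRow isT) /= Ea.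
        by rewrite (fa aMat isT) (fa aRow isT) /= smat.
      rewrite (take_nth v0) ?o_size // -/x.
      apply: wp_if => /=; rewrite sJ Ex (hv vV isT) /= s2V Ev => evx.
        apply: wp_put => i /=; rewrite sJ Ex (hv vD isT) /= s2D !IH (negPf xm) /=.
        rewrite mem_rcons in_cons eqz_nat (inj_eq val_inj).
        by case: eqP => //= ->; case: (e v x) evx.
      apply: wp_skip => i /=; rewrite IH mem_rcons in_cons.
      by case: eqP => //= ->; rewrite (negPf xm); case: (e v x) evx.
    move=> s3 [hv ha] IH; rewrite /= in hv ha.
    exists (fun x => if (x \in take k o) && e v x then r x - d else r x); split; last 1 first.
    (* A vertex at position [k] or later is outside [take k o], so this pass leaves its residual
       weight unchanged. *)
    + move=> j w0 /=; case: (ltngtP j k) => // [jk /andP[]|kj /andP[_ jn]|-> _]; first by lia.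
      * rewrite (negPf (nth_notin_take _ jn (ltnW kj))) /=.
        by apply: res; rewrite nk kj.
      * rewrite (negPf (nth_notin_take _ kn (leqnn k))) /= (set_nth_default v0) ?o_size //.
    + by rewrite /= (hv vTot isT) /= (_ : (n - t.+1)%N = k); [exact: el' | rewrite /k; lia].
    + by move=> i /=; rewrite IH.
  by apply: wp_if => /= cmp; [apply: wp_assign|apply: wp_skip]; split=> //=; rewrite /d; lia.
move=> s' _ [r [el Cr res]]; split; last by move=> k v0 kn; rewrite Cr; apply: res; lia.
move: el; rewrite subnn take0 (_ : [set x in [::]] = set0); first exact: eliminated_set0.
by apply/setP => x; rewrite !inE.
Qed.

Definition avoids (p : seq 'I_n) v S := misses e v (mem p) S /\ v \notin S.

Definition marginals k s : Prop := forall j v0 (v := nth v0 o j), (j < k)%N ->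
  best e c (fun S => v \in S) (arr s aIn j%:Z) /\
  best e c (avoids (take j o) v) (arr s aMiss j%:Z).

Definition visiting k (v : 'I_n) s : Prop :=
  [/\ (k < n)%N, nth v o k = v, var s vK = k%:Z, var s vV = (v : nat)%:Z &
      matrix_of s /\ ordered o s].

Lemma adj_ordered (v v0 : 'I_n) s j : matrix_of s -> ordered o s -> (j < n)%N ->
  arr s aMat (arr s aRow (v : nat)%:Z + arr s aOrd j%:Z) = (e v (nth v0 o j) : nat)%:Z.
Proof. by move=> sm so jn; rewrite (so v0) ?o_size. Qed.

Lemma wp_find_parent k v s : visiting k v s ->
  wp find_parent (fun s' =>
    (var s' vU = -1 /\ {in take k o, forall x, ~~ e v x}) \/
    exists j, [/\ (j < k)%N, var s' vU = j%:Z, e v (nth v o j) &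
      forall i, (j < i < k)%N -> ~~ e v (nth v o i)]) s.
Proof.
move=> [kn nk sK sV [sm so]].
apply: wp_seq; apply: wp_assign; apply: wp_seq; apply: wp_assign.
apply: (@wp_for _ _ _ _ 0 k (fun m s' =>
  (var s' vU = -1 /\ {in take m o, forall x, ~~ e v x}) \/
  exists j, [/\ (j < m)%N, var s' vU = j%:Z, e v (nth v o j) &
    forall i, (j < i < m)%N -> ~~ e v (nth v o i)])) => //=.
- by rewrite ltnW.
- by move=> s' [fv _]; rewrite (fv vK isT).
- by left; rewrite take0.
move=> m s' mk [fv fa] sJ IH; rewrite /= in fv fa.
have mn := ltn_trans mk kn.
apply: wp_if => /=; rewrite sJ (fv vV isT) /= sV (fa aMat isT) (fa aRow isT) (fa aOrd isT)
  /= (adj_ordered v v) // => adj_vm.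
  apply: wp_assign; right; exists m; split=> //=; last by move=> i; lia.
  by case: (e v _) adj_vm.
have {}adj_vm : ~~ e v (nth v o m) by case: (e v _) adj_vm.
apply: wp_skip; case: IH => [[sU IH]|[j [jm sU evj IH]]]; [left|right].
  split=> // x; rewrite (take_nth v) ?o_size // mem_rcons in_cons.
  by case/predU1P => [->|/IH].
exists j; split=> //; first by rewrite ltnS ltnW.
move=> i /andP[ji]; rewrite ltnS leq_eqVlt => /predU1P[->|im] //.
by apply: IH; rewrite ji.
Qed.

Lemma order_peo j v0 : (j < n)%N ->
  {in take j o &, forall x y, e (nth v0 o j) x -> e (nth v0 o j) y -> x != y -> e x y}.
Proof. by move=> jn x y xp yp; apply: (o_peo (split_order v0 jn) xp yp). Qed.

Lemma wp_avoid_later k v s : visiting k v s -> marginals k s ->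
  best e c (fun=> True) (var s vTot) ->
  wp avoid_later (fun s' => best e c (fun S => misses e v (mem (take k o)) S) (var s' vT)) s.
Proof.
move=> vis marg tot; have [kn nk sK sV [sm so]] := vis.
apply: wp_seq; apply: wp_conseq (wp_find_parent vis) => s1 par [fv fa]; rewrite /= in fv fa.
apply: wp_seq; apply: wp_assign; case: par => [[sU no]|[j [jk sU evj no]]].
  apply: wp_if => /=; rewrite sU // => _; apply: wp_skip.
  by rewrite /= (fv vTot isT); apply: best_no_neighbour.
apply: wp_if => /=; rewrite sU // => _; set u := nth v o j in evj.
have jn := ltn_trans jk kn.
have Ek : take k o = take j o ++ u :: drop j.+1 (take k o).
  rewrite -[X in X ++ _](take_takel o (ltnW jk)) /u -(nth_take v jk).
  by rewrite -drop_nth ?cat_take_drop // size_take o_size kn.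
have no' : {in drop j.+1 (take k o), forall x, ~~ e v x}.
  move=> x /(nthP v)[i]; rewrite size_drop size_take o_size kn nth_drop => ik <-.
  by rewrite nth_take ?no; lia.
have Nv : {in take k o &, forall x y, e v x -> e v y -> x != y -> e x y}.
  by have := @order_peo k v kn; rewrite nk.
have Nu := @order_peo j v jn.
have [_ Au] := marg j v jk.
apply: wp_seq; apply: wp_assign; apply: wp_seq; apply: wp_assign.
apply: wp_seq; apply: wp_assign => /=.
rewrite sU (fa aMiss isT) (fa aOrd isT) (so v) ?o_size //.
(* The maximum starts from the sets missing [u] and its earlier neighbours; each pass admits the
   sets through one more earlier neighbour of [u] that is not adjacent to [v]. At the end this is
   the family of [best_parent]. *)
apply: (@wp_for _ _ _ _ 0 j (fun m s2 => best e c (fun S => avoids (take j o) u S \/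
   exists y, [/\ y \in take m o, e u y && ~~ e v y & y \in S]) (var s2 vT))) => //=.
- by rewrite ltnW.
- by move=> s2 [gv _]; rewrite (gv vU isT).
- by rewrite take0; apply: best_nil.
- move=> m s2 mj [gv ga] sJ IH; rewrite /= in gv ga.
  have mn := ltn_trans mj jn; pose x := nth v o m.
  have [inx _] := marg m v (ltn_trans mj jk).
  rewrite (take_nth v) ?o_size // -/x.
  have step := best_rcons (a := fun y => e u y && ~~ e v y) IH inx.
  have E y : arr s2 aMat (arr s2 aRow (nat_of_ord y)%:Z + arr s2 aOrd m%:Z) = (e y x : nat)%:Z.
    rewrite (ga aMat isT) (ga aRow isT) (ga aOrd isT) /=.
    by rewrite (fa aMat isT) (fa aRow isT) (fa aOrd isT) (adj_ordered y v).
  have EB : arr s2 aIn m%:Z = arr s aIn m%:Z by rewrite (ga aIn isT) /= (fa aIn isT).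
  rewrite -EB in step.
  apply: wp_if => /=; rewrite sJ (gv vW isT) /= E => eux; last first.
    by apply: wp_skip; case: (e u x) eux step.
  have {eux} eux : e u x by case: (e u x) eux.
  rewrite eux in step.
  apply: wp_if => /=; rewrite sJ (gv vV isT) /= (fv vV isT) sV E => evx; last first.
    by apply: wp_skip; case: (e v x) evx step.
  have {evx} evx : ~~ e v x by case: (e v x) evx.
  rewrite evx /= in step.
  apply: wp_if => /=; rewrite sJ => le.
    by apply: wp_assign; rewrite /= sJ; move: step; rewrite max_r.
  by apply: wp_skip; move: step; rewrite max_l // ltW.
move=> s2 _; exact: best_parent Ek evj no' Nv Nu.
Qed.

Lemma wp_avoid_vertex k v s : visiting k v s -> marginals k s ->
  best e c (avoids (take k o) v) (arr s aMiss k%:Z) ->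
  wp avoid_vertex (fun s' => best e c (fun S => v \notin S) (var s' vZ)) s.
Proof.
move=> [kn nk sK sV [sm so]] marg avo.
apply: wp_seq; apply: wp_assign; apply: wp_seq; apply: wp_assign.
apply: (@wp_for _ _ _ _ 0 k (fun m s2 => best e c (fun S => avoids (take k o) v S \/
   exists y, [/\ y \in take m o, e v y & y \in S]) (var s2 vZ))) => //=.
- by rewrite ltnW.
- by move=> s2 [gv _]; rewrite (gv vK isT).
- by rewrite take0 sK; apply: best_nil.
- move=> m s2 mk [gv ga] sJ IH; rewrite /= in gv ga.
  have mn := ltn_trans mk kn; pose x := nth v o m.
  have [inx _] := marg m v mk.
  rewrite (take_nth v) ?o_size // -/x.
  have step := best_rcons (a := e v) IH inx.
  have E : arr s2 aMat (arr s2 aRow (nat_of_ord v)%:Z + arr s2 aOrd m%:Z) = (e v x : nat)%:Z.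
    by rewrite (ga aMat isT) (ga aRow isT) (ga aOrd isT) (adj_ordered v v).
  have EB : arr s2 aIn m%:Z = arr s aIn m%:Z by rewrite (ga aIn isT).
  rewrite -EB in step.
  apply: wp_if => /=; rewrite sJ (gv vV isT) /= sV E => evx; last first.
    by apply: wp_skip; case: (e v x) evx step.
  have {evx} evx : e v x by case: (e v x) evx.
  rewrite evx in step.
  apply: wp_if => /=; rewrite sJ => le.
    by apply: wp_assign; rewrite /= sJ; move: step; rewrite max_r.
  by apply: wp_skip; move: step; rewrite max_l // ltW.
by move=> s2 _; apply: best_notin.
Qed.

End Elimination.

(** * Correctness of the filtering *)

Section Filter.
Variables (o : seq 'I_n) (w : 'I_n -> nat) (D : 'I_n -> {set bool}) (zlo : int).
Hypotheses (o_uniq : uniq o) (o_size : size o = n) (o_peo : reverse_peo e o).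
Let c := penalized w D.

Lemma wp_filter_domains s : var s var_n = n%:Z -> matrix_of s -> ordered o s ->
  best e c (fun=> True) (var s vTot) ->
  var s vThr = threshold w D zlo ->
  (forall k v0 (v := nth v0 o k), (k < n)%N ->
      residual_spec c (take k o) v (arr s aC (v : nat)%:Z)) ->
  wp filter_domains (fun s' => forall (i : 'I_n) a,
    arr s' (arr_dom a) (i : nat)%:Z = (a \in filtered e w D zlo i : nat)%:Z) s.
Proof.
move=> sn sm so stot sthr sres; apply: wp_seq; apply: wp_assign.
(* The domains are overwritten in place: this pass never reads them, since they enter only through
   the weights [c]. *)
apply: (@wp_for _ _ _ _ 0 n (fun k s' => marginals o c k s' /\
  forall j v0 (v := nth v0 o j) a, (j < k)%N ->
    arr s' (arr_dom a) (v : nat)%:Z = (a \in filtered e w D zlo v : nat)%:Z)) => //=.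
- by move=> s' [fv _]; rewrite (fv var_n isT).
- move=> k s1 kn [fv fa] sK [marg dom]; rewrite /= in fv fa.
  pose v0 := Ordinal kn; pose v := nth v0 o k.
  have vk : nth v o k = v by apply: set_nth_default; rewrite o_size.
  apply: wp_seq; apply: wp_assign; rewrite /= sK (fa aOrd isT) /= (so v0) ?o_size // -/v.
  set s2 := set_var _ _ _.
  have vis : visiting o k v s2.
    split=> //; split=> [i j|w0 t tn] /=; last by rewrite (fa aOrd isT) /= (so w0).
    by rewrite (fa aMat isT) (fa aRow isT) /= sm.
  have marg2 : marginals o c k s2 by exact: marg.
  have tot2 : best e c (fun=> True) (var s2 vTot) by rewrite /= (fv vTot isT).
  apply: wp_seq; apply: wp_conseq (wp_avoid_later o_uniq o_size o_peo vis marg2 tot2).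
  move=> s3 bT [gv ga]; rewrite /= in gv ga.
  have [bin bout] := sres k v0 kn _ bT.
  have Er : arr s3 aC (var s3 vV) = arr s aC (v : nat)%:Z.
    by rewrite (ga aC isT) (gv vV isT) /= (fa aC isT).
  have s3K : var s3 vK = k%:Z by rewrite (gv vK isT).
  apply: wp_seq; apply: wp_assign; apply: wp_seq.
  apply: (@wp_conseq _ _ _ (fun s4 =>
    [/\ best e c (fun S => v \in S) (arr s4 aIn k%:Z),
        best e c (avoids (take k o) v) (arr s4 aMiss k%:Z) &
        forall j, (j < k)%N -> arr s4 aIn j%:Z = arr s3 aIn j%:Z /\
          arr s4 aMiss j%:Z = arr s3 aMiss j%:Z])).
    move=> s4 [b1 b2 old] [hv ha]; rewrite /= in hv ha.
    have marg4 : marginals o c k s4.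
      move=> j w0 ? jk /=; have [-> ->] := old j jk.
      by rewrite (ga aIn isT) (ga aMiss isT); apply: marg2.
    have vis4 : visiting o k v s4.
      case: vis => _ _ E2 E3 [E4 E5]; split=> //.
      - by rewrite (hv vK isT) /= (gv vK isT).
      - by rewrite (hv vV isT) /= (gv vV isT).
      split=> [i j|w0 t tn].
        by rewrite (ha aMat isT) (ha aRow isT) (ga aMat isT) (ga aRow isT) E4.
      by rewrite (ha aOrd isT) (ga aOrd isT) (E5 w0).
    apply: wp_seq; apply: wp_conseq (wp_avoid_vertex o_size vis4 marg4 b2).
    move=> s5 bZ [jv ja]; rewrite /= in jv ja.
    have s5V : var s5 vV = (v : nat)%:Z by rewrite (jv vV isT); case: vis4.
    have s5K : var s5 vK = k%:Z by rewrite (jv vK isT); case: vis4.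
    have s5t : var s5 vThr = threshold w D zlo.
      by rewrite (jv vThr isT) (hv vThr isT) /= (gv vThr isT) /= (fv vThr isT).
    have E1 : (threshold w D zlo <= arr s5 aIn k%:Z) = (true \in filtered e w D zlo v).
      rewrite (ja aIn isT); apply: best_filtered; apply: is_max_ext b1 => S.
      by split=> -[st]; [move=> -> | move=> vS; split].
    have E0 : (threshold w D zlo <= var s5 vZ) = (false \in filtered e w D zlo v).
      apply: best_filtered; apply: is_max_ext bZ => S.
      by split=> -[st]; [move/negPf | move/negbT].
    (* The final tests change only the cells of [v] in the two domain arrays, numbered 3 and 4. *)
    pose fin s' := [/\ forall a, arr s' (arr_dom a) =1
        (fun x => if x == (v : nat)%:Z then (a \in filtered e w D zlo v : nat)%:Z
                  else arr s5 (arr_dom a) x)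
      & forall a, a \notin [:: 3; 4] -> arr s' a = arr s5 a].
    apply: (@wp_conseq _ _ _ fin).
      move=> s6 [dom6 arr6] _; split.
        move=> j w0 /=; rewrite ltnS leq_eqVlt => /predU1P[->|jk] /=.
          rewrite (set_nth_default v0) ?o_size // -/v !arr6 // (ja aIn isT) (ja aMiss isT).
          by split.
        by rewrite !arr6 // (ja aIn isT) (ja aMiss isT); apply: marg4.
      move=> j w0 /= a; rewrite ltnS leq_eqVlt => /predU1P[->|jk] /=.
        by rewrite (set_nth_default v0) ?o_size // -/v dom6 eqxx.
      rewrite dom6 eqz_nat val_eqE (set_nth_default v0) ?o_size ?(ltn_trans jk) //.
      rewrite nth_uniq ?o_size ?(ltn_trans jk) // ltn_eqF //.
      by rewrite (ja (arr_dom a)) ?(ha (arr_dom a)) /= ?(ga (arr_dom a)) ?dom //; case: (a).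
    apply: wp_seq; apply: wp_if => /=; rewrite s5t s5K => t1; apply: wp_put;
      apply: wp_if => /=; rewrite s5t => t0; apply: wp_put;
      move: t1 t0; rewrite ?ltNge E1 E0 => t1 t0; (split=> [a x|a] /=;
        last by rewrite !inE negb_or => /andP[/negPf-> /negPf->]);
      by case: a => /=; rewrite s5V; case: ifP => // _; move: t1 t0;
        case: (_ \in _) => //; case: (_ \in _).
  have old m1 m2 j : (j < k)%N ->
      (if j%:Z == k%:Z then m1 else m2) = m2 :> int.
    by move=> jk; rewrite eqz_nat ltn_eqF.
  rewrite -Er in bin bout.
  apply: wp_if => /= r0; apply: wp_seq; do 2 apply: wp_put; rewrite /= s3K;
    split; rewrite /= ?eqxx //; try by move=> j jk; rewrite !old.
  + by move: bin; rewrite min_l // => /best_misses_in.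
  + by move: bout; rewrite max_r // subr0.
  + by move: bin; rewrite min_r ?ltW // addr0 => /best_misses_in.
  + by move: bout; rewrite max_l // ltW.
move=> s' _ [_ dom] i a.
(* A duplicate-free list of [n] vertices contains them all. *)
have io : i \in o.
  apply: contraT => io.
  have : (#|o| < #|'I_n|)%N.
    by apply: proper_card; apply/properP; split; [apply/subsetP | exists i].
  by rewrite (card_uniqP o_uniq) o_size card_ord ltnn.
have := io; rewrite -index_mem o_size => jn.
by have := dom (index i o) i a jn; rewrite /= nth_index.
Qed.

End Filter.

End Correctness.

(** * The whole program, its cost and its correctness *)

Local Open Scope cmd_scope.

(** The first test on [var_zlo] forms the maximum of 0 and [zlo] in the threshold. The consistency
    flag is initially 0, so the inconsistent case ends with [Skip]. *)
Definition arc_consistency : cmd :=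
  build_matrix ;; build_weights ;; search ;; eliminate ;;
  vThr ::= Var vBase ;;
  If (Const 0) (Var var_zlo) (vThr ::= Add (Var vThr) (Var var_zlo)) Skip ;;
  filter_domains ;;
  If (Var vThr) (Var vTot) (
    var_consistent ::= Const 1 ;;
    If (Defs.Sub (Var vTot) (Var vBase)) (Var var_zhi)
      (var_zhi ::= Defs.Sub (Var vTot) (Var vBase)) Skip) Skip.

Local Close Scope cmd_scope.

(** Loops are nested at most two deep, so the cost is a quadratic polynomial in [n], whose
    coefficients 500 absorbs. *)
Lemma cost_arc_consistency n : cost n arc_consistency <= 500 * n.+1 ^ 2.
Proof.
by rewrite -mulnn /=; lia. Qed.

Section Input.
Variables (n : nat) (e : rel 'I_n) (adj : 'I_n -> seq 'I_n) (w : 'I_n -> nat).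
Variables (D : 'I_n -> {set bool}) (zlo zhi : int).
Local Open Scope ring_scope.

Lemma tableE (f : 'I_n -> int) (i : 'I_n) : table f (i : nat)%:Z = f i.
Proof. by rewrite /table /= (nth_map i) ?size_enum_ord // nth_ord_enum. Qed.

Lemma adjacency_input_input : adjacency_input adj (input adj w D zlo zhi).
Proof.
split=> //.
- move=> k kn; transitivity (nth 0 [seq (offset adj m)%:Z | m <- iota 0 n.+1] k); first by [].
  rewrite (nth_map 0%N) ?size_iota ?ltnS //.
  by rewrite nth_iota ?ltnS.
- by move=> k j0 t tk; apply: nth_adjacency.
Qed.

Lemma constraint_input_input : constraint_input w D (input adj w D zlo zhi).
Proof. by split=> // i; apply: (tableE (fun i => _)). Qed.

Hypotheses (e_sym : symmetric e) (e_irr : irreflexive e) (e_ch : chordal e).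
Hypothesis adjP : adjacency_lists e adj.

Lemma wp_arc_consistency : wp n arc_consistency (arc_consistency_achieved w D zlo zhi e)
  (input adj w D zlo zhi).
Proof.
set s0 := input _ _ _ _ _.
have [ain cin] : adjacency_input adj s0 /\ constraint_input w D s0.
  by split; [apply: adjacency_input_input | apply: constraint_input_input].
apply: wp_seq; apply: wp_conseq (wp_build_matrix adjP ain) => s1 m1 [v1 a1].
rewrite /= in v1 a1.
have cin1 : constraint_input w D s1.
  case: cin => c1 c2 c3 c4; split=> [|i|i|i]; rewrite ?(v1 var_n isT) //.
  - by rewrite (a1 arr_weight isT).
  - by rewrite (a1 (arr_dom false) isT).
  - by rewrite (a1 (arr_dom true) isT).
apply: wp_seq; apply: wp_conseq (wp_build_weights cin1) => s2 [b2 c2] [v2 a2].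
rewrite /= in v2 a2.
have n2 : var s2 var_n = n%:Z by rewrite (v2 var_n isT) (v1 var_n isT).
have m2 : matrix_of e s2 by move=> i j; rewrite (a2 aMat isT) (a2 aRow isT).
apply: wp_seq; apply: wp_conseq (wp_search e_sym n2 m2 _ _).
- move=> s3 [o [uo so co oo]] [v3 a3]; rewrite /= in v3 a3.
  have peo := chordal_reverse_peo e_sym e_irr e_ch uo co.
  have n3 : var s3 var_n = n%:Z by rewrite (v3 var_n isT).
  have m3 : matrix_of e s3 by move=> i j; rewrite (a3 aMat isT) (a3 aRow isT).
  have c3 (i : 'I_n) : arr s3 aC (i : nat)%:Z = penalized w D i by rewrite (a3 aC isT).
  apply: wp_seq; apply: wp_conseq (wp_eliminate e_sym e_irr uo so peo n3 m3 oo c3).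
  move=> s4 [tot4 res4] [v4 a4]; rewrite /= in v4 a4.
  apply: wp_seq; apply: wp_assign; apply: wp_seq.
  apply: (@wp_conseq _ _ _ (fun s => var s vThr = threshold w D zlo)); last first.
    have E1 : var s4 var_zlo = zlo.
      by rewrite (v4 var_zlo isT) (v3 var_zlo isT) (v2 var_zlo isT) (v1 var_zlo isT).
    have E8 : var s4 vBase = base w D by rewrite (v4 vBase isT) (v3 vBase isT) b2.
    apply: wp_if => /=; rewrite E1 => z0; [apply: wp_assign|apply: wp_skip];
      rewrite /= ?E1 E8 /threshold; lia.
  move=> s5 t5 [v5 a5]; rewrite /= in v5 a5.
  have n5 : var s5 var_n = n%:Z by rewrite (v5 var_n isT) /= (v4 var_n isT).
  have m5 : matrix_of e s5.
    by move=> i j; rewrite (a5 aMat isT) (a5 aRow isT) /= (a4 aMat isT) (a4 aRow isT).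
  have o5 : ordered o s5 by move=> w0 t tn; rewrite (a5 aOrd isT) /= (a4 aOrd isT) (oo w0).
  have tot5 : best e (penalized w D) (fun=> True) (var s5 vTot) by rewrite (v5 vTot isT).
  have res5 k v0 (v := nth v0 o k) : (k < n)%N ->
      residual_spec e (penalized w D) (take k o) v (arr s5 aC (v : nat)%:Z).
    by move=> kn; rewrite (a5 aC isT); apply: res4.
  apply: wp_seq; apply: wp_conseq (wp_filter_domains uo so peo n5 m5 o5 tot5 t5 res5).
  move=> s6 dom6 [v6 a6]; rewrite /= in v6 a6.
  have t6 : var s6 vThr = threshold w D zlo by rewrite (v6 vThr isT).
  have E13 : var s6 vTot = var s5 vTot by rewrite (v6 vTot isT).
  have E8 : var s6 vBase = base w D.
    by rewrite (v6 vBase isT) (v5 vBase isT) /= (v4 vBase isT) (v3 vBase isT) b2.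
  have Ezhi : var s6 var_zhi = zhi.
    rewrite (v6 var_zhi isT) (v5 var_zhi isT) /= (v4 var_zhi isT) (v3 var_zhi isT).
    by rewrite (v2 var_zhi isT) (v1 var_zhi isT).
  have Econ : var s6 var_consistent = 0.
    rewrite (v6 var_consistent isT) (v5 var_consistent isT) /= (v4 var_consistent isT).
    by rewrite (v3 var_consistent isT) (v2 var_consistent isT) (v1 var_consistent isT).
  have Cons := best_consistent zlo tot5.
  apply: wp_if => /=; rewrite t6 E13 => le; last first.
    have nc : consistent e w D zlo = false by rewrite -Cons lt_geF.
    by apply: wp_skip; rewrite /arc_consistency_achieved nc Econ.
  have Ez := best_zstar tot5 le.
  rewrite Cons in le.
  apply: wp_seq; apply: wp_assign; apply: wp_if => /=; rewrite Ezhi E13 E8 Ez => cz;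
    [apply: wp_assign|apply: wp_skip]; rewrite /arc_consistency_achieved le /=;
    (split=> // _; split; [|exact: dom6]).
    by rewrite E13 E8 Ez; lia.
  by rewrite Ezhi; lia.
- by move=> k; rewrite (a2 aVis isT) (a1 aVis isT).
- by move=> k; rewrite (a2 aCnt isT) (a1 aCnt isT).
Qed.

End Input.

Theorem theorem4 :
  exists P : cmd, forall K : nat, exists C : nat,
  forall (n : nat) (e : rel 'I_n) (adj : 'I_n -> seq 'I_n)
         (w : 'I_n -> nat) (D : 'I_n -> {set bool}) (zlo zhi : int),
    symmetric e -> irreflexive e -> chordal e -> adjacency_lists e adj ->
    (zlo <= zhi)%R ->
    exists (t : nat) (s : state),
      [/\ exec P (input adj w D zlo zhi) t s,
          arc_consistency_achieved w D zlo zhi e s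
        & 0 < n -> n <= K * #|edges e| ->
          t <= C * (#|maximal_cliques e| * #|edges e|)].
Proof.
(* The factor 4 comes from [n.+1 ^ 2 <= 4 * n ^ 2] for positive [n], and [K + 2] from bounding
   [2 * #|edges e| + n] by means of [n <= K * #|edges e|]. *)
exists arc_consistency => K; exists (500 * 4 * (K + 2)).
move=> n e adj w D zlo zhi e_sym e_irr e_ch adjP _.
have [t [s [ex le ok]]] := wp_arc_consistency w D zlo zhi e_sym e_irr e_ch adjP.
exists t, s; split=> // n0 nK.
apply: leq_trans le (leq_trans (cost_arc_consistency n) _).
rewrite -!mulnA leq_mul2l /=; apply: leq_trans (_ : 4 * n ^ 2 <= _).
  by rewrite -[4]/(2 ^ 2) -expnMn leq_exp2r //; lia.
rewrite leq_mul2l /=; apply: leq_trans (sqrn_leq_cliques_edges e_irr) _.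
by rewrite mulnCA leq_mul2l mulnDl addnC leq_add2r nK orbT.
Qed.
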